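(* Let $(M,g)$ be a simply-connected complete Cartan-Hadamard Riemannian manifold of dimension $n\ge 2$, and let $p\in M$. Then $M\setminus\{p\}$ is expanding throughout the radial geodesic vector field centered at $p$.
   Context: A Cartan-Hadamard manifold here is a Riemannian manifold with non-positive sectional curvature (simple connectedness is stated separately). For such $M$, the map $\exp_p$ is a global diffeomorphism, and by geodesic polar coordinates $(r,v)\mapsto\exp_p(rv)$, where $v$ ranges over the unit sphere $\mathbb S^{n-1}\subset T_pM$, the manifold $(M\setminus\{p\},g)$ is isometric to $((0,\infty)\times\mathbb S^{n-1},\,dr^2+h_r)$ for a smooth one-parameter family of Riemannian metrics $h_r$ on $\mathbb S^{n-1}$; $\partial_r$ is the radial geodesic vector field centered at $p$. A Riemannian manifold of the form $(I\times F,\beta\,dt^2+g_t)$, with $I\subseteq\mathbb R$ an open interval, $(g_t)_{t\in I}$ a smooth family of Riemannian metrics on $F$ and $\beta>0$ smooth, is expanding throughout $\partial_t$ if $\partial_t\beta\ge0$ and $(\partial_tg_t)(X,X)>0$ for every $t\in I$ and every nonzero vector $X$ tangent to $F$. Here this is applied with $t=r$, $I=(0,\infty)$, $F=\mathbb S^{n-1}$, $\beta=1$, $g_t=h_r$. *)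

(* Defs.v *)
From HB Require Import structures.
From mathcomp Require Import all_boot all_order all_algebra.
From mathcomp Require Import all_classical all_reals all_analysis.
Set Implicit Arguments.
Unset Strict Implicit.
Unset Printing Implicit Defensive.
Import Order.TTheory GRing.Theory Num.Theory.
Import numFieldNormedType.Exports.
Local Open Scope classical_set_scope.
Local Open Scope ring_scope.

(* [Ck k U f] is meant for open [U] and finite-dimensional [V]. *)
Fixpoint Ck (R : realType) (V W : normedModType R) (k : nat) (U : set V)
    (f : V -> W) {struct k} : Prop :=
  (forall x, U x -> {for x, continuous f}) /\
  match k with
  | 0 => True
  | k'.+1 => forall v : V,
      (forall x, U x -> derivable f x v) /\ Ck k' U (fun x => 'D_v f x)
  end.

Definition smooth_on (R : realType) (V W : normedModType R) (U : set V)
    (f : V -> W) : Prop :=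
  forall k, Ck k U f.

(* [param c] is the inverse of the chart [chart_map c] on the open set
   [chart_map c @` chart_dom c]; both maps are unconstrained elsewhere.  The
   preferred chart [chart_at x] identifies the tangent space at [x] with R^n:
   tangent vectors at [x] are given by their components in [chart_at x]. *)
Record smooth_manifold (R : realType) (n : nat) := SmoothManifold {
  carrier :> topologicalType ;
  chart : Type ;
  chart_dom : chart -> set carrier ;
  chart_map : chart -> carrier -> 'rV[R]_n ;
  param : chart -> 'rV[R]_n -> carrier ;
  chart_at : carrier -> chart ;
  manifold_hausdorff : hausdorff_space carrier ;
  manifold_second_countable : @second_countable carrier ;
  chart_at_dom : forall x, chart_dom (chart_at x) x ;
  chart_dom_open : forall c, open (chart_dom c) ;
  chart_image_open : forall c, open (chart_map c @` chart_dom c) ;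
  chart_mapK : forall c x, chart_dom c x -> param c (chart_map c x) = x ;
  chart_map_continuous : forall c x, chart_dom c x ->
    {for x, continuous (chart_map c)} ;
  param_continuous : forall c x, chart_dom c x ->
    {for chart_map c x, continuous (param c)} ;
  transition_smooth : forall c d,
    smooth_on (chart_map c @` (chart_dom c `&` chart_dom d))
              (chart_map d \o param c)
}.

Definition bil (R : realType) (n : nat) (A : 'M[R]_n) (u w : 'rV[R]_n) : R :=
  (u *m A *m w^T) 0 0.

(* A metric is the family of its component matrices [metric_mx c y], for [y] in
   the image of the chart [c], related by the tensor transformation law. *)
Record riemannian_metric (R : realType) (n : nat) (M : smooth_manifold R n) :=
  RiemannianMetric {
  metric_mx :> chart M -> 'rV[R]_n -> 'M[R]_n ;
  metric_smooth : forall c,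
    smooth_on (chart_map c @` chart_dom c) (metric_mx c) ;
  metric_sym : forall c (x : M), chart_dom c x ->
    (metric_mx c (chart_map c x))^T = metric_mx c (chart_map c x) ;
  metric_pos : forall c (x : M), chart_dom c x ->
    forall u, u != 0 -> 0 < bil (metric_mx c (chart_map c x)) u u ;
  metric_change : forall c d (x : M), chart_dom c x -> chart_dom d x ->
    forall u w,
      bil (metric_mx c (chart_map c x)) u w =
      bil (metric_mx d (chart_map d x))
          ('D_u (chart_map d \o param c) (chart_map c x))
          ('D_w (chart_map d \o param c) (chart_map c x))
}.

Section local_geometry.
Variables (R : realType) (n : nat) (G : 'rV[R]_n -> 'M[R]_n).

Definition partial (i : 'I_n) (f : 'rV[R]_n -> R) (y : 'rV[R]_n) : R :=
  'D_(delta_mx 0 i) f y.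

(* Gamma^k_ij *)
Definition christoffel (k i j : 'I_n) (y : 'rV[R]_n) : R :=
  2^-1 * \sum_(l < n) invmx (G y) k l *
    (partial i (fun z => G z j l) y + partial j (fun z => G z i l) y
     - partial l (fun z => G z i j) y).

(* R^l_ijk, where R(d_i, d_j) d_k = \sum_l R^l_ijk d_l and
   R(X, Y) Z = nabla_X nabla_Y Z - nabla_Y nabla_X Z - nabla_[X, Y] Z. *)
Definition curvature_coef (l i j k : 'I_n) (y : 'rV[R]_n) : R :=
  partial i (christoffel l j k) y - partial j (christoffel l i k) y
  + \sum_(m < n) (christoffel m j k y * christoffel l i m y
                  - christoffel m i k y * christoffel l j m y).

Definition curvature (y X Y Z : 'rV[R]_n) : 'rV[R]_n :=
  \row_l \sum_(i < n) \sum_(j < n) \sum_(k < n)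
    curvature_coef l i j k y * X 0 i * Y 0 j * Z 0 k.

Definition sectional_curvature (y X Y : 'rV[R]_n) : R :=
  bil (G y) (curvature y X Y Y) X /
  (bil (G y) X X * bil (G y) Y Y - bil (G y) X Y ^+ 2).

(* - \sum_ij Gamma^k_ij u^i u^j, the acceleration of a geodesic at [y] with
   velocity [u] *)
Definition geodesic_acceleration (y u : 'rV[R]_n) : 'rV[R]_n :=
  \row_k - \sum_(i < n) \sum_(j < n) christoffel k i j y * u 0 i * u 0 j.

End local_geometry.

Section riemannian.
Variables (R : realType) (n : nat) (M : smooth_manifold R n).
Variable g : riemannian_metric M.

Definition metric_at (x : M) (u w : 'rV[R]_n) : R :=
  bil (g (chart_at x) (chart_map (chart_at x) x)) u w.

Definition nonpositive_sectional_curvature : Prop :=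
  forall (c : chart M) (x : M), chart_dom c x ->
  forall X Y : 'rV[R]_n, row_free (col_mx X Y) ->
    sectional_curvature (g c) (chart_map c x) X Y <= 0.

Definition geodesic (gam : R -> M) : Prop :=
  continuous gam /\
  forall (t : R) (c : chart M), chart_dom c (gam t) ->
    let x := chart_map c \o gam in
    [/\ derivable x t 1,
        derivable (derive1 x) t 1 &
        derive1 (derive1 x) t = geodesic_acceleration (g c) (x t) (derive1 x t)].

Definition geodesic_from (p : M) (v : 'rV[R]_n) (gam : R -> M) : Prop :=
  [/\ geodesic gam, gam 0 = p & derive1 (chart_map (chart_at p) \o gam) 0 = v].

Definition geodesically_complete : Prop :=
  forall (p : M) (v : 'rV[R]_n), exists gam, geodesic_from p v gam.

(* [exp_map p v] is the value at time 1 of the geodesic issued from [p] with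
   velocity [v]; the default [p] is used only when there is no such geodesic
   defined on the whole of R. *)
Definition exp_map (p : M) (v : 'rV[R]_n) : M :=
  xget p [set gam 1 | gam in geodesic_from p v].

Definition unit_sphere (p : M) : set 'rV[R]_n :=
  [set v | metric_at p v v = 1].

Definition sphere_tangent (p : M) (v : 'rV[R]_n) : set 'rV[R]_n :=
  [set X | metric_at p v X = 0].

(* The metrics h_r of the polar form dr^2 + h_r of the metric: h_r is the
   pullback of [g] by the map w |-> exp_p (r w) on the unit sphere of T_p M. *)
Definition polar_metric (p : M) (r : R) (v X Y : 'rV[R]_n) : R :=
  let q := exp_map p (r *: v) in
  let f w := chart_map (chart_at q) (exp_map p (r *: w)) in
  metric_at q ('D_X f v) ('D_Y f v).

End riemannian.

Definition simply_connected (R : realType) (T : topologicalType) : Prop :=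
  (forall x y : T, exists gam : R -> T,
     [/\ {within `[0, 1], continuous gam}, gam 0 = x & gam 1 = y]) /\
  (forall gam : R -> T,
     {within `[0, 1], continuous gam} -> gam 0 = gam 1 ->
     exists H : R * R -> T,
       [/\ {within `[0, 1] `*` `[0, 1], continuous H},
           forall s : R, s \in `[0, 1] -> H (0, s) = gam s,
           forall s : R, s \in `[0, 1] -> H (1, s) = gam 0 &
           forall t : R, t \in `[0, 1] -> H (t, 0) = gam 0 /\ H (t, 1) = gam 0]).

(* The expanding condition for beta dt^2 + g_t on I x F, where F is a
   submanifold of R^n, with tangent spaces [TF x], and where [gt t x] is the
   bilinear form g_t at the point x of F. *)
Definition expanding (R : realType) (n : nat) (I : set R) (F : set 'rV[R]_n)
    (TF : 'rV[R]_n -> set 'rV[R]_n) (beta : R -> 'rV[R]_n -> R)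
    (gt : R -> 'rV[R]_n -> 'rV[R]_n -> 'rV[R]_n -> R) : Prop :=
  forall (t : R) (x : 'rV[R]_n), I t -> F x ->
    [/\ derivable (fun s => beta s x) t 1,
        0 <= derive1 (fun s => beta s x) t &
        forall X : 'rV[R]_n, TF x X -> X != 0 ->
          derivable (fun s => gt s x X X) t 1 /\
          0 < derive1 (fun s => gt s x X X) t].

(* The expanding condition for dr^2 + h_r, i.e. for M \ {p} in geodesic polar
   coordinates (r, v) |-> exp_p (r v). *)
Definition expanding_radially (R : realType) (n : nat)
    (M : smooth_manifold R n) (g : riemannian_metric M) (p : M) : Prop :=
  expanding `]0, +oo[ (unit_sphere g p) (sphere_tangent g p)
            (fun _ _ => 1) (polar_metric g p).

(* Main.v *)
From HB Require Import structures.
Require Import Defs.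
From mathcomp Require Import all_boot all_order all_algebra.
From mathcomp Require Import all_classical all_reals all_analysis.
From mathcomp Require Import perm ring lra.

(* Let gamma_w be the geodesic with gamma_w(0) = p and gamma_w'(0) = w.  Then
   h_r(X, X) = |J(r)|^2, where J(r) is the derivative of gamma_{v + hX}(r) with
   respect to h at h = 0: a Jacobi field with J(0) = 0 and covariant derivative
   X at r = 0.  Hence half the derivative of |J|^2 is <DJ/dr, J>, which vanishes
   at 0 and whose derivative |DJ/dr|^2 - <R(J, gamma')gamma', J> is nonnegative,
   because of the curvature assumption, and positive near 0, because X <> 0.

   The differentiability of geodesics in h is proved chart by chart.  The
   geodesic field is strictly differentiable, so the difference quotients in h
   satisfy approximately the linearised equation; they form a uniform Cauchy
   family whose limit solves it.  Compactness of closed balls inside a chart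
   keeps nearby geodesics in the chart. *)

Set Implicit Arguments.
Unset Strict Implicit.
Unset Printing Implicit Defensive.
Import Order.TTheory GRing.Theory Num.Theory.
Import numFieldNormedType.Exports.
Local Open Scope classical_set_scope.
Local Open Scope ring_scope.

(** * Strict differentiability *)

(** [Ck] only provides continuous directional derivatives, whereas linearising along a geodesic
    compares the field at two moving points, uniformly in time. Strict differentiability bridges the
    two: it follows from continuous partial derivatives, passes through sums, products, inverses and
    composition, and gives a local Lipschitz constant. It is applied to the metric and the
    transition maps and to their first derivatives, hence to Christoffel symbols and to changes of
    chart on tangent vectors. Completeness supplies geodesics one at a time, with no regularity in
    [h]; all dependence on [h] is extracted from Gronwall estimates, without integrals or a flow.
    Since [polar_metric] involves a directional derivative of the exponential, only the family with
    initial velocities [v + h *: X] is considered. The estimates hold on time windows short compared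
    with the Lipschitz constant of the field in one chart. Passing to all positive times is a
    continuous induction on statements about every chart around the current point, so that the chart
    may change from one window to the next. *)

Lemma real_induction (R : realType) (a b : R) (P : R -> Prop) :
  a <= b -> P a ->
  (forall t, a < t <= b -> (forall s, a <= s < t -> P s) -> P t) ->
  (forall t, a <= t < b -> P t -> \forall s \near t, t < s -> P s) ->
  forall t, a <= t <= b -> P t.
Proof.
move=> ab Pa Pl Pr.
(* Asking for [P] on all of [[a, t]] makes the supremum a member of the set, by the step from the
   left; the step to the right then forbids a supremum before [b]. *)
pose E := [set t | a <= t <= b /\ forall s, a <= s <= t -> P s].
have Ea : E a.
  by split=> [|s]; [rewrite lexx | rewrite -eq_le => /eqP <-].
have Eub : ubound E b by move=> t [/andP[]].
have hE : has_sup E by split; [exists a | exists b].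
set m := sup E.
have am : a <= m by exact: sup_upper_bound.
have mb : m <= b by apply: ge_sup => //; exists a.
have Pltm s : a <= s < m -> P s.
  move=> /andP[as_ sm]; have [t [Et Pt] st] := sup_gt (ex_intro _ a Ea) sm.
  by apply: Pt; rewrite as_ ltW.
have Pm : P m.
  have [<-//|am'] := eqVneq a m.
  by apply: Pl => //; rewrite lt_neqAle am' am.
have Em s : a <= s <= m -> P s.
  move=> /andP[as_]; rewrite le_eqVlt => /predU1P[->//|sm].
  by apply: Pltm; rewrite as_.
have [mb'|] := ltP m b; last first.
  by move=> bm t /andP[at_ tb]; apply: Em; rewrite at_ (le_trans tb).
have /nbhs_ballP[d /= d0 Pd] := Pr m (introT andP (conj am mb')) Pm.
pose m' := Num.min (m + d / 2) b.
have mm' : m < m' by rewrite lt_min mb' ltrDl divr_gt0.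
suff : E m' by move=> /(sup_upper_bound hE); rewrite -/m leNgt mm'.
split=> [|s /andP[as_ sm']].
  by rewrite (le_trans am (ltW mm'))/= ge_min lexx orbT.
have [sm|ms] := leP s m; first by apply: Em; rewrite as_.
apply: Pd => //; rewrite /ball /= distrC gtr0_norm ?subr_gt0// ltrBlDl.
rewrite (@le_lt_trans _ _ (m + d / 2))//; first by rewrite (le_trans sm')// ge_min lexx.
by rewrite ltrD2l ltr_pdivrMr// ltr_pMr// ltr1n.
Qed.

Section eps_delta.
Variables (R : realType) (V W : normedModType R).
Implicit Types f : V -> W.

Lemma derivable_expansion f a v e : derivable f a v -> 0 < e ->
  \forall h \near (0 : R), `|f (h *: v + a) - f a - h *: 'D_v f a| <= e * `|h|.
Proof.
move=> /derivable_nbhs /eqaddoP/(_ e) + e0 => /(_ e0).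
by apply: filterS => h; rewrite !fctE/= opprD addrA.
Qed.

Lemma is_derive_expansion f a v l :
  (forall e, 0 < e ->
    \forall h \near (0 : R), `|f (h *: v + a) - f a - h *: l| <= e * `|h|) ->
  is_derive a v f l.
Proof.
move=> H.
have cl : h^-1 *: ((f \o shift a) (h *: v) - f a) @[h --> 0^'] --> l.
  apply/cvgrPdist_le => e e0; have := H e e0.
  rewrite near_withinE; apply: filterS => h fh h0.
  rewrite -[l](scalerK h0) -scalerBr normrZ normfV ler_pdivrMl ?normr_gt0//.
  by rewrite distrC mulrC.
by split; [apply/cvg_ex; exists l | apply/cvg_lim].
Qed.

Lemma diff_expansion f x (L : {linear V -> W}) : continuous L ->
  (forall e, 0 < e ->
    \forall y \near x, `|f y - f x - L (y - x)| <= e * `|y - x|) ->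
  differentiable f x /\ 'd f x = L :> (V -> W).
Proof.
move=> cL H.
have E : f \o shift x = cst (f x) + L +o_ 0 id.
  apply/eqaddoP => e e0; have := H e e0.
  rewrite (near_shift 0 x) => {}H.
  apply: filterS H => y; rewrite !fctE/= subr0 addrK.
  by rewrite opprD addrA.
have dE : 'd f x = L :> (V -> W) by exact: diff_unique.
by split=> //; apply/diff_locallyP; rewrite dE.
Qed.

End eps_delta.

(** * Growth estimates for vector-valued curves *)

Section curves.
Variables (R : realType) (V : normedModType R).
Implicit Types w : R -> V.

Lemma is_derive1_expansion w dw (t e : R) : is_derive t 1 w dw -> 0 < e ->
  \forall s \near t, `|w s - w t - (s - t) *: dw| <= e * `|s - t|.
Proof.
move=> [dw' <-] e0; have := derivable_expansion dw' e0.
rewrite (near_shift t 0) => H.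
apply: filterS H => s; rewrite /= sub0r.
by rewrite [(_ - _) *: (1 : R)]mulr1 subrK.
Qed.

Lemma is_derive1_continuous w dw (t : R) : is_derive t 1 w dw ->
  {for t, continuous w}.
Proof.
by move=> [dw' _]; apply: differentiable_continuous; apply/derivable1_diffP.
Qed.

(** A vector-valued curve need not attain its mean slope, so the bound is carried along by
    continuous induction. With slope [C + e] the slack [e] absorbs the first-order remainder; it is
    sent to 0 at the end. *)
Lemma mean_value_ineq w (dw : R -> V) (a b C : R) : a <= b ->
  (forall t, a <= t <= b -> is_derive t 1 w (dw t)) ->
  (forall t, a <= t <= b -> `|dw t| <= C) ->
  `|w b - w a| <= C * (b - a).
Proof.
move=> ab Dw Cw.
have C0 : 0 <= C by apply: le_trans (Cw a _) => //; rewrite lexx.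
have main e : 0 < e -> forall t, a <= t <= b -> `|w t - w a| <= (C + e) * (t - a).
  move=> e0; apply: real_induction => //.
  - by rewrite !subrr normr0 mulr0.
  - move=> t /andP[at_ tb] IH.
    apply/ler_addgt0Pr => eta eta0.
    have /is_derive1_continuous/cvgrPdist_le/(_ eta eta0) :=
      Dw t (introT andP (conj (ltW at_) tb)).
    move=> /nbhs_ballP[d /= d0 Hd].
    pose s := Num.max a (t - d / 2).
    have st : s < t by rewrite gt_max at_ ltrBlDr ltrDl divr_gt0.
    have as_ : a <= s by rewrite le_max lexx.
    have := IH s; rewrite as_ st => /(_ isT) IHs.
    have wts : `|w t - w s| <= eta.
      apply: Hd; rewrite /ball /= gtr0_norm ?subr_gt0// ltrBlDr -ltrBlDl.
      rewrite (@lt_le_trans _ _ (t - d / 2)) ?le_max ?lexx ?orbT//.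
      by rewrite ltrD2l ltrN2 ltr_pdivrMr// ltr_pMr// ltr1n.
    rewrite -[w t](subrK (w s)) -addrA (le_trans (ler_normD _ _))//.
    rewrite [leLHS]addrC lerD//; apply: le_trans IHs _.
    by apply: ler_wpM2l; rewrite ?lerD2r ?addr_ge0// ltW.
  - move=> t /andP[at_ tb] Pt.
    have atb : a <= t <= b by rewrite at_ ltW.
    have := is_derive1_expansion (Dw t atb) e0.
    apply: filterS => s ws ts.
    rewrite -[w s](subrK (w t)) -addrA.
    rewrite (le_trans (ler_normD _ _))//.
    rewrite -[s in leRHS](subrK t) -addrA mulrDr lerD//.
    rewrite -[w s - w t](subrK ((s - t) *: dw t)) (le_trans (ler_normD _ _))//.
    rewrite mulrDl [leLHS]addrC lerD// ?normrZ.
      by rewrite gtr0_norm ?subr_gt0// mulrC; apply: ler_wpM2r; [rewrite subr_ge0 ltW | exact: Cw].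
    by rewrite gtr0_norm ?subr_gt0// in ws.
have [->|ba] := eqVneq b a; first by rewrite !subrr normr0 mulr0.
have ba0 : 0 < b - a by rewrite subr_gt0 lt_neqAle eq_sym ba.
apply/ler_addgt0Pr => e e0.
have := main (e / (b - a)) (divr_gt0 e0 ba0) b; rewrite ab lexx => /(_ isT).
by rewrite mulrDl divfK// gt_eqF.
Qed.

(* On an interval short compared with the Lipschitz constant [L], this replaces
   Gronwall's inequality: the maximum of [`|w|] absorbs its own growth. *)
Lemma short_gronwall w (dw : R -> V) (a b L e : R) : a <= b ->
  0 <= L -> L * (b - a) <= 2^-1 -> 0 <= e ->
  (forall t, a <= t <= b -> is_derive t 1 w (dw t)) ->
  (forall t, a <= t <= b -> `|dw t| <= L * `|w t| + e) ->
  forall t, a <= t <= b -> `|w t| <= 2 * (`|w a| + e * (b - a)).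
Proof.
move=> ab L0 Lab e0 Dw dwL.
have cw : {within `[a, b], continuous (fun t => `|w t|)}.
  apply: continuous_in_subspaceT => t; rewrite inE/= in_itv/= => /Dw dt.
  by apply: continuous_comp; [exact: is_derive1_continuous dt | exact: norm_continuous].
have [s + smax] := EVT_max ab cw; rewrite in_itv/= => /andP[as_ sb].
have sup_ t : a <= t <= b -> `|w t| <= `|w s|.
  by move=> tab; apply: smax; rewrite in_itv.
suff ws : `|w s| <= 2 * (`|w a| + e * (b - a)).
  by move=> t /sup_ /le_trans; exact.
have : `|w s - w a| <= (L * `|w s| + e) * (s - a).
  apply: (mean_value_ineq (dw := dw)) => // t /andP[at_ ts];
    have tab : a <= t <= b by rewrite at_ (le_trans ts).
  - exact: Dw.
  - by rewrite (le_trans (dwL _ _))// lerD2r ler_wpM2l// sup_.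
have wsa : `|w s| <= `|w s - w a| + `|w a|.
  by rewrite -[X in `|X| <= _](subrK (w a)) ler_normD.
have sba : (L * `|w s| + e) * (s - a) <= (L * `|w s| + e) * (b - a).
  by rewrite ler_wpM2l ?addr_ge0 ?mulr_ge0// lerD2r.
have : L * (b - a) * `|w s| <= 2^-1 * `|w s| by rewrite ler_wpM2r.
move: (normr_ge0 (w s)) (normr_ge0 (w a)) => *; lra.
Qed.

End curves.

(** Both points vary near [x], which makes this the pointwise form of being C^1: [f] is Lipschitz on
    a neighbourhood, and its derivative, wherever it exists nearby, is close to the one at [x]. *)
Definition strictly_differentiable (R : realType) (V W : normedModType R)
    (f : V -> W) (x : V) : Prop :=
  differentiable f x /\
  forall e, 0 < e -> \forall p \near (x, x),
    `|f p.1 - f p.2 - 'd f x (p.1 - p.2)| <= e * `|p.1 - p.2|.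

(** * Calculus of strictly differentiable maps *)

Section strict_differentiability.
Variable R : realType.
Implicit Types U V W : normedModType R.

Lemma le_norm_half W (x y : W) (e c : R) :
  `|x| <= e / 2 * c -> `|y| <= e / 2 * c -> `|x + y| <= e * c.
Proof.
move=> xe ye; apply: le_trans (ler_normD _ _) _.
by rewrite [e]splitr mulrDl; exact: lerD.
Qed.

Lemma cvg_diag (T U : topologicalType) (f : T -> U) (x : T) :
  {for x, continuous f} -> (f p.1, f p.2) @[p --> (x, x)] --> (f x, f x).
Proof.
move=> fx; apply: cvg_pair.
  by apply: (@cvg_comp _ _ _ fst f _ (nbhs x)) => //; exact: cvg_fst.
by apply: (@cvg_comp _ _ _ snd f _ (nbhs x)) => //; exact: cvg_snd.
Qed.

Lemma sdiff_intro V W (f : V -> W) x (L : {linear V -> W}) : continuous L ->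
  (forall e, 0 < e -> \forall p \near (x, x),
    `|f p.1 - f p.2 - L (p.1 - p.2)| <= e * `|p.1 - p.2|) ->
  strictly_differentiable f x.
Proof.
move=> cL H; have [df dE] : differentiable f x /\ 'd f x = L :> (V -> W).
  apply: diff_expansion => // e e0.
  have : (y, x) @[y --> x] --> (x, x) by apply: cvg_pair => //; exact: cvg_cst.
  by move=> /(_ _ (H e e0)).
by split; rewrite ?dE.
Qed.

Lemma near_sdiff V W (f g : V -> W) x : (\near x, f x = g x) ->
  strictly_differentiable f x -> strictly_differentiable g x.
Proof.
move=> fg [df H]; apply: (@sdiff_intro _ _ _ _ ('d f x)) => [|e e0].
  exact: diff_continuous.
have fg1 : \forall p \near (x, x), f p.1 = g p.1 by exact: cvg_fst fg.
have fg2 : \forall p \near (x, x), f p.2 = g p.2 by exact: cvg_snd fg.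
by near=> p; rewrite -(near fg1 p)// -(near fg2 p)//; near: p; exact: H.
Unshelve. all: by end_near. Qed.

Lemma linear_sdiff V W (L : {linear V -> W}) x : continuous L ->
  strictly_differentiable L x.
Proof.
move=> cL; apply: (sdiff_intro cL) => e e0; near=> p.
by rewrite -linearB subrr normr0 mulr_ge0// ltW.
Unshelve. all: by end_near. Qed.

Lemma sdiff_cst V W (a : W) (x : V) : strictly_differentiable (fun=> a) x.
Proof.
split=> [|e e0]; first exact: differentiable_cst.
by near=> p; rewrite diff_cst !subrr normr0 mulr_ge0// ltW.
Unshelve. all: by end_near. Qed.

Lemma sdiffD V W (f g : V -> W) x : strictly_differentiable f x ->
  strictly_differentiable g x -> strictly_differentiable (fun y => f y + g y) x.
Proof.
move=> [df Hf] [dg Hg]; split=> [|e e0]; first exact: differentiableD.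
have e2 : 0 < e / 2 by rewrite divr_gt0.
rewrite (diffD df dg); apply: filterS2 (Hf _ e2) (Hg _ e2) => p Hfp Hgp.
have -> : f p.1 + g p.1 - (f p.2 + g p.2) - (('d f x \+ 'd g x) (p.1 - p.2)) =
  (f p.1 - f p.2 - 'd f x (p.1 - p.2)) + (g p.1 - g p.2 - 'd g x (p.1 - p.2)).
  by rewrite /= !opprD (addrACA (f p.1)) (addrACA (f p.1 - f p.2)).
exact: le_norm_half.
Qed.

Lemma sdiff_sum V W (I : Type) (r : seq I) (f : I -> V -> W) x :
  (forall i, strictly_differentiable (f i) x) ->
  strictly_differentiable (fun y => \sum_(i <- r) f i y) x.
Proof.
move=> df; elim: r => [|i r IH].
  by under eq_fun do rewrite big_nil; exact: sdiff_cst.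
under eq_fun do rewrite big_cons.
exact: (@sdiffD _ _ (f i) (fun y => \sum_(j <- r) f j y) x (df i) IH).
Qed.

Lemma sdiff_pair U V W (f : U -> V) (g : U -> W) x :
  strictly_differentiable f x -> strictly_differentiable g x ->
  strictly_differentiable (fun y => (f y, g y)) x.
Proof.
move=> [df Hf] [dg Hg]; split=> [|e e0]; first exact: differentiable_pair.
near=> p; rewrite (diff_pair df dg)/=.
rewrite [leLHS]/Num.norm/= ge_max; apply/andP; split; near: p; [exact: Hf|exact: Hg].
Unshelve. all: by end_near. Qed.

Lemma sdiff_lipschitz V W (f : V -> W) x : strictly_differentiable f x ->
  exists2 L, 0 < L & \forall p \near (x, x), `|f p.1 - f p.2| <= L * `|p.1 - p.2|.
Proof.
move=> [df H]; have [k k0 kf] := linear_lipschitz (diff_continuous df).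
exists (k + 1); first by rewrite addr_gt0.
apply: filterS (H 1 ltr01) => p Hp.
rewrite -[X in `|X|](subrK ('d f x (p.1 - p.2))) (le_trans (ler_normD _ _))//.
by rewrite mulrDl addrC lerD.
Qed.

Lemma sdiff_comp U V W (f : U -> V) (g : V -> W) x :
  strictly_differentiable f x -> strictly_differentiable g (f x) ->
  strictly_differentiable (fun y => g (f y)) x.
Proof.
move=> sf [dg Hg]; have [df Hf] := sf.
split=> [|e e0]; first exact: (differentiable_comp df dg).
have [k k0 kg] := linear_lipschitz (diff_continuous dg).
have [l l0 lf] := sdiff_lipschitz sf.
have cf : (f p.1, f p.2) @[p --> (x, x)] --> (f x, f x).
  by apply: cvg_diag; exact: differentiable_continuous.
(* The remainder of [g] is measured by increments of [f], at most [l] times those of the argument;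
   the remainder of [f] is stretched by ['d g] at most [k] times. *)
have e1 : 0 < e / 2 / l by rewrite !divr_gt0.
have e2 : 0 < e / 2 / k by rewrite !divr_gt0.
near=> p; have -> : 'd (fun y => g (f y)) x = 'd g (f x) \o 'd f x :> (U -> W).
  exact: (diff_comp df dg).
rewrite -[X in `|X|](subrK ('d g (f x) (f p.1 - f p.2 - 'd f x (p.1 - p.2)))).
apply: le_norm_half.
  rewrite (linearB ('d g (f x)) (f p.1 - f p.2)) opprB addrA.
  rewrite -[X in _ - X + _]/('d g (f x) ('d f x (p.1 - p.2))) subrK.
  have : `|g (f p.1) - g (f p.2) - 'd g (f x) (f p.1 - f p.2)| <=
    e / 2 / l * `|f p.1 - f p.2| by near: p; apply: cf (Hg _ e1).
  move=> /le_trans; apply.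
  rewrite -mulrA ler_pM2l ?divr_gt0// ler_pdivrMl//.
  by near: p; exact: lf.
apply: le_trans (kg _) _.
rewrite -ler_pdivlMl// mulrA [k^-1 * _]mulrC; near: p; exact: Hf.
Unshelve. all: by end_near. Qed.

Lemma sdiff_mul (x : R * R) : strictly_differentiable (fun q : R * R => q.1 * q.2) x.
Proof.
have dm : is_diff x (fun q : R * R => q.1 * q.2) _ := is_diff_mulr x.
split=> [|e e0]; first exact: ex_diff.
rewrite diff_val; near=> p => /=.
(* The remainder is a sum of two products, each of a small distance to [x] by an increment. *)
have -> : p.1.1 * p.1.2 - p.2.1 * p.2.2 -
    (x.1 *: (p.1.2 - p.2.2) + (p.1.1 - p.2.1) *: x.2) =
    (p.1.1 - x.1) * (p.1.2 - p.2.2) + (p.1.1 - p.2.1) * (p.2.2 - x.2).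
  by rewrite /GRing.scale/=; ring.
have px : `|p.1 - x| <= e / 2.
  by near: p; apply: (@cvgr_distC_le _ _ _ _ _ (fun p => p.1) x); [exact: cvg_fst|rewrite divr_gt0].
have qx : `|p.2 - x| <= e / 2.
  by near: p; apply: (@cvgr_distC_le _ _ _ _ _ (fun p => p.2) x); [exact: cvg_snd|rewrite divr_gt0].
have n1 (q : R * R) : `|q.1| <= `|q| by rewrite [leRHS]/Num.norm/= le_max lexx.
have n2 (q : R * R) : `|q.2| <= `|q| by rewrite [leRHS]/Num.norm/= le_max lexx orbT.
apply: le_norm_half; rewrite normrM.
  by apply: ler_pM => //; [exact: le_trans (n1 (p.1 - x)) px | exact: (n2 (p.1 - p.2))].
by rewrite mulrC; apply: ler_pM => //; [exact: le_trans (n2 (p.2 - x)) qx | exact: (n1 (p.1 - p.2))].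
Unshelve. all: by end_near. Qed.

Lemma sdiffM V (f g : V -> R) x : strictly_differentiable f x ->
  strictly_differentiable g x -> strictly_differentiable (fun y => f y * g y) x.
Proof. by move=> sf sg; apply: sdiff_comp (sdiff_pair sf sg) (sdiff_mul _). Qed.

Lemma sdiff_inv (a : R) : a != 0 -> strictly_differentiable (fun y : R => y^-1) a.
Proof.
move=> a0; split=> [|e e0]; first exact: differentiable_Rinv.
rewrite diff_Rinv//.
have ca : (p.1 * p.2)^-1 @[p --> (a, a)] --> (a * a)^-1.
  apply: cvgV; first by rewrite mulf_neq0.
  by apply: cvgM; [exact: cvg_fst | exact: cvg_snd].
have na : \forall y \near a, y != 0 by apply: (@cvgr_neq0 _ _ _ (nbhs a) _ id a).
have n1 : \forall p \near (a, a), p.1 != 0 by exact: cvg_fst na.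
have n2 : \forall p \near (a, a), p.2 != 0 by exact: cvg_snd na.
near=> p => /=.
have p1 : p.1 != 0 by near: p.
have p2 : p.2 != 0 by near: p.
have -> : p.1^-1 - p.2^-1 - (- a ^- 2 *: (p.1 - p.2)) =
    ((a * a)^-1 - (p.1 * p.2)^-1) * (p.1 - p.2).
  rewrite /GRing.scale/=; field.
  by rewrite a0 p1 p2.
rewrite normrM ler_wpM2r//; near: p; apply: cvgr_dist_le ca _ e0.
Unshelve. all: by end_near. Qed.

Lemma sdiffV V (f : V -> R) x : f x != 0 -> strictly_differentiable f x ->
  strictly_differentiable (fun y => (f y)^-1) x.
Proof. by move=> f0 sf; apply: sdiff_comp sf (sdiff_inv f0). Qed.

End strict_differentiability.

Lemma mean_value_ineq_sym (R : realType) (V : normedModType R) (w dw : R -> V)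
    (a b C : R) :
  (forall t, Num.min a b <= t <= Num.max a b -> is_derive t 1 w (dw t)) ->
  (forall t, Num.min a b <= t <= Num.max a b -> `|dw t| <= C) ->
  `|w b - w a| <= C * `|b - a|.
Proof.
have [ab|ba] := leP a b => Dw Cw.
  by rewrite ger0_norm ?subr_ge0//; exact: mean_value_ineq Dw Cw.
by rewrite distrC [`|b - a|]distrC gtr0_norm ?subr_gt0//; exact: mean_value_ineq (ltW ba) Dw Cw.
Qed.

Section matrix_norm.
Variables (R : realType) (m n : nat).
Implicit Types M : 'M[R]_(m, n).

Lemma mx_norm_coord M i j : `|M i j| <= `|M|.
Proof.
by rewrite [leRHS]/Num.norm/= mx_normrE; apply/bigmax_geP; right => /=; exists (i, j).
Qed.

Lemma mx_norm_lt M c : 0 < c -> (forall i j, `|M i j| < c) -> `|M| < c.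
Proof.
by move=> c0 Mc; rewrite [ltLHS]/Num.norm/= mx_normrE; apply: bigmax_lt.
Qed.

End matrix_norm.

Lemma continuous_sum (R : realType) (T : topologicalType) (W : normedModType R)
    (I : Type) (r : seq I) (F : I -> T -> W) (x : T) :
  (forall i, {for x, continuous (F i)}) ->
  {for x, continuous (fun y => \sum_(i <- r) F i y)}.
Proof.
move=> cF; elim: r => [|i r IH]; rewrite /prop_for /continuous_at.
  by under eq_fun do rewrite big_nil; rewrite big_nil; exact: cvg_cst.
rewrite big_cons; under eq_fun do rewrite big_cons.
by apply: (@cvgD _ _ _ _ _ (F i) (fun y => \sum_(j <- r) F j y)); [exact: cF | exact: IH].
Qed.

(** * From continuous partial derivatives to strict differentiability *)

Section C1.
Variable R : realType.

Lemma is_derive_line (V W : normedModType R) (f : V -> W) (q v : V) (c s : R) :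
  derivable f (q + (s - c) *: v) v ->
  is_derive s 1 (fun t : R => f (q + (t - c) *: v)) ('D_v f (q + (s - c) *: v)).
Proof.
have E : (fun h : R => h^-1 *: (((fun t : R => f (q + (t - c) *: v)) \o shift s) (h *: (1 : R))
    - f (q + (s - c) *: v))) =
  (fun h : R => h^-1 *: ((f \o shift (q + (s - c) *: v)) (h *: v) - f (q + (s - c) *: v))).
  apply/funext => h /=; congr (_ *: (f _ - _)).
  by rewrite [h *: 1]mulr1 -addrA scalerDl addrCA.
by move=> df; split; [rewrite /derivable E | rewrite /derive E].
Qed.

Lemma is_derive_scalel (V : normedModType R) (c : V) (s : R) :
  is_derive s 1 (fun t : R => t *: c) c.
Proof.
apply: is_derive_expansion => e e0; near=> h.
rewrite [h *: 1]mulr1 scalerDl addrK subrr normr0.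
by rewrite mulr_ge0// ltW.
Unshelve. all: by end_near. Qed.

(** Strictness at [x] compares the increment of [f] from [y] to [y + h v] with [h] times the
    derivative at [x]; differentiability at [y] compares it with [h] times the derivative at [y].
    Dividing by a small [h] compares the derivatives. *)
Lemma sdiff_diff_near (V W : normedModType R) (f : V -> W) (x : V) (e : R) :
  strictly_differentiable f x -> 0 < e ->
  \forall y \near x, differentiable f y ->
    forall v, `|'d f y v - 'd f x v| <= e * `|v|.
Proof.
move=> [df H] e0; have [[A B]/= [Ax Bx] AB] := H e e0.
near=> y => dy v; apply/ler_addgt0Pr => r r0.
have By : B y by near: y.
have Ay : \forall h \near (0 : R), A (h *: v + y).
  have cy : h *: v + y @[h --> (0 : R)] --> y.
    rewrite -[X in _ --> X]add0r -(scale0r v).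
    by apply: cvgD; [apply: cvgZr_tmp; exact: cvg_id | exact: cvg_cst].
  by apply: cy; near: y; exact: (near_join Ax).
have dvy : derivable f y v by exact: diff_derivable.
have : \forall h \near (0 : R), A (h *: v + y) /\
    `|f (h *: v + y) - f y - h *: 'D_v f y| <= r * `|h|.
  by apply: filterI Ay _; exact: derivable_expansion.
move=> /nbhs_ballP[d /= d0 Hd].
have h0 : 0 < d / 2 by rewrite divr_gt0.
have [Ah] : A (d / 2 *: v + y) /\
    `|f (d / 2 *: v + y) - f y - d / 2 *: 'D_v f y| <= r * `|d / 2|.
  apply: Hd; rewrite /ball /= sub0r normrN gtr0_norm//.
  by rewrite ltr_pdivrMr// ltr_pMr// ltr1n.
have /= := AB (d / 2 *: v + y, y) (conj Ah By).
rewrite addrK (deriveE _ dy) linearZ /= normrZ => E1 E2.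
rewrite -(ler_pM2l h0) -[X in X * _ <= _](gtr0_norm h0) -normrZ.
rewrite [leRHS]mulrDr [_ * r]mulrC -[X in _ + r * X](gtr0_norm h0).
rewrite mulrCA -[X in e * (X * _)](gtr0_norm h0).
apply: le_trans (lerD E1 E2).
move: (f _ - f y) => D; rewrite scalerBr.
rewrite [X in _ <= X + _]distrC.
have -> : d / 2 *: 'd f y v - d / 2 *: 'd f x v =
  - (D - d / 2 *: 'd f y v) - (d / 2 *: 'd f x v - D).
  by rewrite 2!opprB subrKA.
by rewrite (le_trans (ler_normB _ _))// addrC normrN.
Unshelve. all: by end_near. Qed.

(** Going from [z] to [y] one coordinate at a time, each move involves a single partial derivative,
    which stays close to its value at [x]. *)
Lemma partial_sdiff n (W : normedModType R) (f : 'rV[R]_n -> W) (x : 'rV[R]_n) :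
  (\forall y \near x, forall i, derivable f y (delta_mx 0 i)) ->
  (forall i, {for x, continuous ('D_(delta_mx 0 i) f)}) ->
  strictly_differentiable f x.
Proof.
move=> fd fc.
pose L (v : 'rV[R]_n) := \sum_i v 0 i *: 'D_(delta_mx 0 i) f x.
have linL : linear L.
  move=> a u v; rewrite /L scaler_sumr -big_split; apply: eq_bigr => i _.
  by rewrite !mxE scalerDl scalerA.
pose L' : {linear 'rV[R]_n -> W} := HB.pack L (GRing.isLinear.Build _ _ _ _ L linL).
have cL : continuous L'.
  move=> v; apply: continuous_sum => i.
  apply: differentiable_continuous; apply: differentiableZl.
  exact: differentiable_coord.
apply: (sdiff_intro cL) => e e0.
(* There are [n] moves, each of error [e'] times the norm; the successor keeps the divisor
   nonzero. *)
pose e' := e / n.+1%:R.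
have e'0 : 0 < e' by rewrite divr_gt0.
have : \forall y \near x, forall i, derivable f y (delta_mx 0 i) /\
   `|'D_(delta_mx 0 i) f y - 'D_(delta_mx 0 i) f x| <= e'.
  have H : \forall y \near x, forall i, `|'D_(delta_mx 0 i) f y - 'D_(delta_mx 0 i) f x| <= e'.
    apply: (@filter_forall _ _ (fun i y => `|'D_(delta_mx 0 i) f y - 'D_(delta_mx 0 i) f x| <= e') (nbhs x) (nbhs_filter x)) => i.
    by have /cvgrPdistC_le/(_ e' e'0) := fc i.
  by apply: filterS2 fd H => y H1 H2 i; split.
move=> /nbhs_ballP[r /= r0 Hr].
exists (ball x r, ball x r); first by split; exact: nbhsx_ballx.
move=> [y z] [/=]; rewrite -ball_normE /= => yr zr.
(* The first [k] coordinates already come from [y]. As the norm is the maximum norm, the segments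
   between consecutive points stay in the ball. *)
pose q k : 'rV[R]_n := \row_i (if (i < k)%N then y 0 i else z 0 i).
have q0 : q 0%N = z by apply/rowP => i; rewrite mxE.
have qn : q n = y by apply/rowP => i; rewrite mxE ltn_ord.
have -> : f y - f z - L (y - z) =
  \sum_(k < n) (f (q k.+1) - f (q k) - (y - z) 0 k *: 'D_(delta_mx 0 k) f x).
  rewrite sumrB; congr (_ - _).
  by rewrite -(big_mkord xpredT (fun k => f (q k.+1) - f (q k))) telescope_sumr// q0 qn.
have yz0 : 0 <= `|y - z| by [].
apply: le_trans (ler_norm_sum _ _ _) _.
apply: (@le_trans _ _ (\sum_(k < n) e' * `|y - z|)); last first.
  rewrite sumr_const card_ord -mulr_natl mulrA; apply: ler_wpM2r => //.
  rewrite /e' mulrA ler_pdivrMr// mulrC; apply: ler_wpM2l; first exact: ltW.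
  by rewrite ler_nat.
apply: ler_sum => k _.
apply: (@le_trans _ _ (e' * `|(y - z) 0 k|)); last first.
  by apply: ler_wpM2l; [exact: ltW | exact: mx_norm_coord].
(* Subtracting the linear prediction turns the derivative of [w] into the deviation of the partial
   derivative from its value at [x], bounded by [e']. *)
pose w s : W := f (q k + (s - z 0 k) *: delta_mx 0 k) - s *: 'D_(delta_mx 0 k) f x.
have qk1 : q k + (y 0 k - z 0 k) *: delta_mx 0 k = q k.+1.
  apply/rowP => i; rewrite !mxE eqxx/=.
  have [->|ik] := eqVneq i k; first by rewrite ltnn ltnSn mulr1 addrC subrK.
  have ik' : (i == k :> nat) = false by exact: negPf ik.
  by rewrite mulr0 addr0 ltnS [(i <= k)%N]leq_eqVlt ik'.
have wE : f (q k.+1) - f (q k) - (y - z) 0 k *: 'D_(delta_mx 0 k) f x =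
    w (y 0 k) - w (z 0 k).
  rewrite /w qk1 subrr scale0r addr0 !mxE scalerBl opprB opprD opprK.
  by rewrite [RHS]addrACA (addrC (z 0 k *: _)).
rewrite wE !mxE.
have qr s : Num.min (z 0 k) (y 0 k) <= s <= Num.max (z 0 k) (y 0 k) ->
    ball x r (q k + (s - z 0 k) *: delta_mx 0 k).
  move=> zsy.
  have yk : `|x 0 k - y 0 k| < r.
    by apply: le_lt_trans yr; have := mx_norm_coord (x - y) 0 k; rewrite !mxE.
  have zk : `|x 0 k - z 0 k| < r.
    by apply: le_lt_trans zr; have := mx_norm_coord (x - z) 0 k; rewrite !mxE.
  rewrite -ball_normE /=; apply: mx_norm_lt => // i j; rewrite ord1 !mxE/=.
  have [->|jk] := eqVneq j k.
    rewrite ltnn mulr1 [z 0 k + _]addrC subrK.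
    move: zsy yk zk; rewrite !ltr_norml; case: (leP (z 0 k)) => _ /andP[? ?] /andP[? ?] /andP[? ?];
    by apply/andP; split; lra.
  rewrite mulr0 addr0; case: ifPn => _.
    by apply: le_lt_trans yr; have := mx_norm_coord (x - y) 0 j; rewrite !mxE.
  by apply: le_lt_trans zr; have := mx_norm_coord (x - z) 0 j; rewrite !mxE.
apply: (mean_value_ineq_sym (dw := fun s =>
  'D_(delta_mx 0 k) f (q k + (s - z 0 k) *: delta_mx 0 k) - 'D_(delta_mx 0 k) f x)).
  move=> s /qr/Hr/(_ k)[dk _]; apply: is_deriveB; first exact: is_derive_line.
  exact: is_derive_scalel.
by move=> s /qr/Hr/(_ k)[_].
Qed.

End C1.

(** * The variational equation *)

Lemma subr_split (V : zmodType) (x y u v : V) :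
  x - y = (u - v) + ((x - u) - (y - v)).
Proof.
have -> : (x - u) - (y - v) = (x - y) - (u - v) by rewrite !opprD !opprK addrACA.
by rewrite [RHS]addrC subrK.
Qed.

Lemma between_itv (R : realType) (a b s t x : R) : a <= s <= b -> a <= t <= b ->
  Num.min s t <= x <= Num.max s t -> a <= x <= b.
Proof.
move=> /andP[as_ sb] /andP[at_ tb] /andP[]; rewrite ge_min le_max => sx xt.
apply/andP; split.
  by case/orP: sx; apply: le_trans.
by case/orP: xt => /le_trans; apply.
Qed.

Lemma between_dist (R : realType) (s t x : R) :
  Num.min t (s + t) <= x <= Num.max t (s + t) -> `|x - t| <= `|s|.
Proof.
have /andP[s1 s2] : - `|s| <= s <= `|s| by rewrite -ler_norml.
have s0 := normr_ge0 s; move=> xst.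
have /andP[? ?] : t - `|s| <= x <= t + `|s|.
  by apply: between_itv xst; apply/andP; split; lra.
by rewrite ler_norml; apply/andP; split; lra.
Qed.

Section variational_equation.
Variables (R : realType) (V : normedModType R).
Hypothesis V_complete : forall F : set_system V, ProperFilter F -> cauchy F -> cvg F.
Variables (F : V -> V) (z : R -> R -> V) (a b L C : R).
Hypotheses (ab : a <= b) (L0 : 0 <= L) (Lab : L * (b - a) <= 2^-1) (C0 : 0 <= C).
Hypothesis zD : \forall h \near (0 : R), forall t, a <= t <= b ->
  is_derive t 1 (z h) (F (z h t)).
Hypothesis F_sdiff : forall t, a <= t <= b -> strictly_differentiable F (z 0 t).
Hypothesis F_bound : forall t, a <= t <= b -> forall v,
  `|'d F (z 0 t) v| <= L * `|v|.
Hypothesis z_stable : \forall h \near (0 : R), forall t, a <= t <= b ->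
  `|z h t - z 0 t| <= C * `|z h a - z 0 a|.
Hypothesis za : derivable (z ^~ a) 0 1.

Let Z h t := h^-1 *: (z h t - z 0 t).
Let DZ h t := h^-1 *: (F (z h t) - F (z 0 t)).

(** The point is uniformity in [t]. Strictness at [z 0 t] serves all nearby times once the
    derivative at [z 0 t] is exchanged for the one at [z 0 t'], by [sdiff_diff_near]; compactness of
    [[a, b]] then gives one neighbourhood of [h = 0]. *)
Let linearization e : 0 < e -> \forall h \near (0 : R), forall t, a <= t <= b ->
  `|F (z h t) - F (z 0 t) - 'd F (z 0 t) (z h t - z 0 t)| <=
  e * `|z h t - z 0 t|.
Proof.
move=> e0.
pose P (h t : R) := a <= t <= b ->
  `|F (z h t) - F (z 0 t) - 'd F (z 0 t) (z h t - z 0 t)| <=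
  e * `|z h t - z 0 t|.
have : near_covering `[a, b].
  by apply/compact_near_coveringP; exact: segment_compact.
move=> /(_ R (nbhs (0 : R)) P _).
suff H : forall t, `[a, b]%classic t -> \forall t' \near t & h \near (0 : R), P h t'.
  by move=> /(_ H); apply: filterS => h Hh t tab; apply: (Hh t) => //=; rewrite in_itv.
move=> t /=; rewrite in_itv/= => tab.
have e2 : 0 < e / 2 by rewrite divr_gt0.
have [[U U'] [/= Ut Ut'] UF] := (F_sdiff tab).2 _ e2.
have [r r0 rU] : exists2 r, 0 < r & forall y, `|z 0 t - y| < r -> [/\ U y, U' y &
    differentiable F y -> forall v, `|'d F y v - 'd F (z 0 t) v| <= e / 2 * `|v|].
  have : \forall y \near z 0 t, [/\ U y, U' y &
    differentiable F y -> forall v, `|'d F y v - 'd F (z 0 t) v| <= e / 2 * `|v|].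
    by near=> y; split; near: y => //; exact: sdiff_diff_near (F_sdiff tab) e2.
  by move=> /nbhs_ballP[r r0]; rewrite -ball_normE; exists r.
(* There is room for two moves of [r / 2]: from [z 0 t] to [z 0 t'] by continuity in time, then to
   [z h t'] by [z_stable]. *)
have r2 : 0 < r / 2 by rewrite divr_gt0.
have zt : {for t, continuous (z 0)}.
  by apply: is_derive1_continuous; apply: (nbhs_singleton zD).
have cza : (fun h => C * `|z h a - z 0 a|) @ (0 : R) --> 0.
  have za0 : z h a @[h --> (0 : R)] --> z 0 a.
    by apply: differentiable_continuous; apply/derivable1_diffP.
  have : (fun h => C * `|z h a - z 0 a|) @ (0 : R) --> C * `|z 0 a - z 0 a|.
    by apply: cvgMl_tmp; apply: cvg_norm; apply: cvgB; [exact: za0 | exact: cvg_cst].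
  by rewrite subrr normr0 mulr0.
have zr : \forall t' \near t, `|z 0 t - z 0 t'| < r / 2.
  by move/cvgrPdist_lt : zt; exact.
have hr : \forall h \near (0 : R), C * `|z h a - z 0 a| < r / 2.
  move/cvgrPdist_lt : cza => /(_ _ r2); apply: filterS => h.
  by rewrite sub0r normrN ger0_norm// mulr_ge0.
near=> t' h => tab' /=.
have zt' : `|z 0 t - z 0 t'| < r / 2 by near: t'.
have zht' : `|z h t' - z 0 t'| < r / 2.
  have : C * `|z h a - z 0 a| < r / 2 by near: h.
  have zs : forall t, a <= t <= b -> `|z h t - z 0 t| <= C * `|z h a - z 0 a|.
    by near: h.
  by apply: le_lt_trans; exact: zs.
have [_ Uz' dFz'] : [/\ U (z 0 t'), U' (z 0 t') & differentiable F (z 0 t') ->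
    forall v, `|'d F (z 0 t') v - 'd F (z 0 t) v| <= e / 2 * `|v|].
  by apply: rU; apply: lt_trans zt' _; rewrite ltr_pdivrMr// ltr_pMr// ltr1n.
have [Uz _ _] : [/\ U (z h t'), U' (z h t') & differentiable F (z h t') ->
    forall v, `|'d F (z h t') v - 'd F (z 0 t) v| <= e / 2 * `|v|].
  apply: rU; rewrite [r]splitr -(subrKA (z 0 t')).
  by apply: le_lt_trans (ler_normD _ _) _; rewrite [`|z 0 t' - _|]distrC ltrD.
have {}dFz' := dFz' (F_sdiff tab').1.
rewrite -(subrKA ('d F (z 0 t) (z h t' - z 0 t'))).
apply: le_norm_half; first exact: (UF (z h t', z 0 t')).
by rewrite -normrN opprB; exact: dFz'.
Unshelve. all: by end_near. Qed.

Let Z_bound : exists2 B, 0 < B &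
  \forall h \near (0 : R)^', forall t, a <= t <= b -> `|Z h t| <= B.
Proof.
pose D := 'D_1 (z ^~ a) 0.
(* Stability multiplies the quotient at [a], eventually at most [|D| + 1], by [C]; the last summand
   makes the bound positive. *)
exists (C * (`|D| + 1) + 1).
  by rewrite ltr_wpDl// mulr_ge0// addr_ge0.
have := derivable_expansion za ltr01.
move=> H; apply: cvg_within; near=> h => t tab.
have zhaD : `|z h a - z 0 a| <= (`|D| + 1) * `|h|.
  have : `|z (h *: 1 + 0) a - z 0 a - h *: D| <= 1 * `|h| by near: h.
  rewrite [h *: 1]mulr1 addr0 => zha.
  rewrite -[X in `|X|](subrK (h *: D)) (le_trans (ler_normD _ _))//.
  by rewrite mulrDl [leLHS]addrC lerD// normrZ mulrC.
have : forall t, a <= t <= b -> `|z h t - z 0 t| <= C * `|z h a - z 0 a| by near: h.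
move=> /(_ t tab).
move=> E1; have E2 := zhaD; rewrite /Z normrZ normfV.
have [->|h0] := eqVneq h 0.
  by rewrite normr0 invr0 mul0r addr_ge0// mulr_ge0// addr_ge0.
rewrite ler_pdivrMl ?normr_gt0//; apply: le_trans E1 _.
have := ler_wpM2l C0 E2; move/le_trans; apply.
by rewrite mulrA mulrC ler_wpM2l// lerDl.
Unshelve. all: by end_near. Qed.

Let A t : {linear V -> V} := 'd F (z 0 t).

Let DZ_approx e : 0 < e -> \forall h \near (0 : R)^', forall t, a <= t <= b ->
  `|DZ h t - A t (Z h t)| <= e.
Proof.
move=> e0; have [B B0 BZ] := Z_bound.
have := linearization (divr_gt0 e0 B0) => lin.
near=> h => t tab.
have /(_ t tab) E : forall t, a <= t <= b ->
    `|F (z h t) - F (z 0 t) - 'd F (z 0 t) (z h t - z 0 t)| <=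
    e / B * `|z h t - z 0 t|.
  by near: h; exact: cvg_within lin.
have /(_ t tab) ZB : forall t, a <= t <= b -> `|Z h t| <= B by near: h.
rewrite /DZ /Z /A linearZ -scalerBr normrZ.
apply: le_trans (ler_wpM2l (normr_ge0 _) E) _.
rewrite mulrCA -normrZ.
apply: le_trans (ler_wpM2l _ ZB) _; first by rewrite divr_ge0 ?ltW.
by rewrite divfK// gt_eqF.
Unshelve. all: by end_near. Qed.

Let is_derive_Z : \forall h \near (0 : R)^', forall t, a <= t <= b ->
  is_derive t 1 (Z h) (DZ h t).
Proof.
near=> h => t tab; apply: is_deriveZ; apply: is_deriveB.
  have : forall t, a <= t <= b -> is_derive t 1 (z h) (F (z h t)).
    by near: h; exact: cvg_within zD.
  exact.
exact: (nbhs_singleton zD).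
Unshelve. all: by end_near. Qed.

Let dnbhs_ex (S : set R) : nbhs (0 : R)^' S -> exists h, S h.
Proof. exact: (@filter_ex _ _ (Proper_dnbhs_numFieldType (0 : R))). Qed.

Let dnbhsI (S T : set R) :
  nbhs (0 : R)^' S -> nbhs (0 : R)^' T -> nbhs (0 : R)^' (S `&` T).
Proof. exact: filterI. Qed.

Let D := 'D_1 (z ^~ a) 0.

Let growth_rate t h :
  h^-1 *: (((z ^~ t) \o shift 0) (h *: (1 : R)) - z 0 t) = Z h t.
Proof. by rewrite /Z /= [h *: 1]mulr1 addr0. Qed.

Let Za_cvg : Z h a @[h --> 0^'] --> D.
Proof. by under eq_fun do rewrite -growth_rate; exact: za. Qed.

(** Two quotients satisfy the same linear equation up to [e1] each and start within [e1] of [D], so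
    Gronwall controls their difference. The set [S] does not depend on [t], which is the uniformity
    used below. *)
Let Z_cauchy e : 0 < e -> exists2 S : set R, nbhs (0 : R)^' S &
  forall h k, S h -> S k -> forall t, a <= t <= b -> `|Z h t - Z k t| <= e.
Proof.
(* Chosen so that the Gronwall bound [2 * (2 * e1 + 2 * e1 * (b - a))] equals [e]. *)
move=> e0; set e1 := e / (4 * (1 + (b - a))).
have ba1 : 0 < 1 + (b - a) by rewrite ltr_pwDl// subr_ge0.
have e10 : 0 < e1 by rewrite divr_gt0// mulr_gt0.
pose S := [set h | [/\ forall t, a <= t <= b -> is_derive t 1 (Z h) (DZ h t),
  forall t, a <= t <= b -> `|DZ h t - A t (Z h t)| <= e1 & `|Z h a - D| <= e1]].
exists S => [|h k [h1 h2 h3] [k1 k2 k3] t tab].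
  near=> h; split.
  - by near: h; exact: is_derive_Z.
  - by near: h; exact: DZ_approx.
  - by near: h; move/cvgrPdistC_le : Za_cvg; exact.
have Zhk : `|Z h a - Z k a| <= 2 * e1.
  rewrite -(subrKA D) [2 * _]mulrDl mul1r; apply: le_trans (ler_normD _ _) _.
  by rewrite lerD// distrC.
apply: (@le_trans _ _ (2 * (`|Z h a - Z k a| + 2 * e1 * (b - a)))).
  apply: (short_gronwall (w := fun t => Z h t - Z k t)
    (dw := fun t => DZ h t - DZ k t) ab L0 Lab) => // [|s sab|s sab].
  - by rewrite mulr_ge0// ltW.
  - by apply: is_deriveB; [exact: h1 | exact: k1].
  - have -> : DZ h s - DZ k s = (A s (Z h s - Z k s)) +
        ((DZ h s - A s (Z h s)) - (DZ k s - A s (Z k s))).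
      by rewrite linearB -subr_split.
    apply: le_trans (ler_normD _ _) _; rewrite lerD ?F_bound//.
    apply: le_trans (ler_normB _ _) _.
    by rewrite [2 * _]mulrDl mul1r lerD ?h2 ?k2.
have -> : e = 2 * (2 * e1 * (1 + (b - a))).
  by rewrite /e1; field; rewrite gt_eqF.
by rewrite ler_pM2l// [leRHS]mulrDr mulr1 lerD2r.
Unshelve. all: by end_near. Qed.

Let J t := 'D_1 (z ^~ t) 0.

Lemma variation_derivable t : a <= t <= b -> derivable (z ^~ t) 0 1.
Proof.
move=> tab; rewrite /derivable; under eq_fun do rewrite growth_rate.
apply: V_complete; apply/cauchyP => e e0.
have [S S0 HS] := Z_cauchy (divr_gt0 e0 (ltr0n _ 2)).
have [k Sk] := dnbhs_ex S0; exists (Z k t).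
apply: filterS S0 => h Sh; rewrite -ball_normE /=.
apply: le_lt_trans (HS _ _ Sk Sh _ tab) _.
by rewrite ltr_pdivrMr// ltr_pMr// ltr1n.
Qed.

Let Z_cvg t : a <= t <= b -> Z h t @[h --> 0^'] --> J t.
Proof.
move=> /variation_derivable.
by rewrite /derivable /J /derive; under eq_fun do rewrite growth_rate.
Qed.

Let Z_unif e : 0 < e -> \forall h \near (0 : R)^', forall t, a <= t <= b ->
  `|Z h t - J t| <= e.
Proof.
move=> e0; have [S S0 HS] := Z_cauchy e0.
apply: (filterS _ S0) => h Sh t tab; apply/ler_addgt0Pr => r r0.
have := Z_cvg tab => /cvgrPdistC_le/(_ r r0) Hr.
have [k [Sk kr]] := dnbhs_ex (dnbhsI S0 Hr).
rewrite -(subrKA (Z k t)); apply: le_trans (ler_normD _ _) _.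
by rewrite lerD// HS.
Qed.

(** [J] is a uniform limit of quotients whose time derivatives are bounded by [1 + L * B]. The
    estimate includes the endpoints, where the differential equation is not stated; it later gives
    the limit at time 0. *)
Lemma variation_lipschitz : exists2 K, 0 <= K & forall s t,
  a <= s <= b -> a <= t <= b -> `|J s - J t| <= K * `|s - t|.
Proof.
have [B B0 BZ] := Z_bound; exists (1 + L * B).
  by rewrite addr_ge0// mulr_ge0// ltW.
move=> s t sab tab; apply/ler_addgt0Pr => r r0.
have r2 : 0 < r / 2 by rewrite divr_gt0.
have [h [[[h1 h2] h3] h4]] := dnbhs_ex (dnbhsI (dnbhsI (dnbhsI BZ (Z_unif r2))
  is_derive_Z) (DZ_approx ltr01)).
rewrite (subr_split _ _ (Z h s) (Z h t)); apply: le_trans (ler_normD _ _) _.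
apply: lerD.
  apply: (mean_value_ineq_sym (dw := DZ h)) => x xst;
    have xab := between_itv tab sab xst.
  - exact: h3.
  - rewrite -[X in `|X|](subrK (A x (Z h x))); apply: le_trans (ler_normD _ _) _.
    apply: lerD; first exact: h4.
    by apply: le_trans (F_bound xab _) _; rewrite ler_wpM2l// h1.
apply: le_trans (ler_normB _ _) _.
by rewrite [r]splitr lerD// distrC h2.
Qed.

(** The derivative passes to the limit through the mean value inequality: for a fixed increment [s],
    [J] is replaced by some [Z h], whose slope between [t] and [s + t] is nearly [A t (J t)]. *)
Lemma variation_is_derive t : a < t < b -> is_derive t 1 J (A t (J t)).
Proof.
move=> tab'; have tab : a <= t <= b by case/andP: tab' => /ltW-> /ltW->.
have [B B0 BZ] := Z_bound; have [K K0 JK] := variation_lipschitz.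
apply: is_derive_expansion => e e0.
have BL0 : 0 < 1 + B + L by rewrite ltr_wpDr// addr_gt0.
have LK0 : 0 < L * K + 1 by rewrite ltr_wpDl// mulr_ge0.
(* Three errors share the first half of [e]: the equation for [Z h] (1), the change of [A] in time
   ([B]), and [Z h] against [J] ([L]). The second half, through [r], pays for the motion of [J],
   which [A t] amplifies to at most [L * K * r]. *)
set e1 := e / 2 / (1 + B + L).
have e10 : 0 < e1 by rewrite !divr_gt0.
set r := e / 2 / (L * K + 1).
have r0 : 0 < r by rewrite !divr_gt0.
have near_t : \forall x \near t, [/\ a < x, x < b, `|x - t| <= r &
    forall v, `|A x v - A t v| <= e1 * `|v|].
  case/andP: tab' => at_ tb.
  have zt : {for t, continuous (z 0)}.
    by apply: is_derive1_continuous; apply: (nbhs_singleton zD).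
  near=> x; have xab : a < x /\ x < b.
    by split; near: x; [exact: lt_nbhsr | exact: lt_nbhsl].
  case: xab => ax xb; split; [exact: ax | exact: xb | |].
    near: x; have : x @[x --> t] --> t by [].
    by move=> /cvgrPdistC_le/(_ r r0).
  have : differentiable F (z 0 x) ->
      forall v : V, `|'d F (z 0 x) v - 'd F (z 0 t) v| <= e1 * `|v|.
    by near: x; exact: (zt _ (sdiff_diff_near (F_sdiff tab) e10)).
  by apply; apply: (F_sdiff _).1; rewrite !ltW.
have [d d0 dt] : exists2 d, 0 < d & forall x, `|x - t| < d -> [/\ a < x, x < b, `|x - t| <= r &
    forall v, `|A x v - A t v| <= e1 * `|v|].
  move/nbhs_ballP : near_t => [d d0 Hd]; exists d => // x xt.
  by apply: Hd; rewrite -ball_normE /= distrC.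
have cid : (s : R) @[s --> 0] --> (0 : R) by [].
have near0 : \forall s \near (0 : R), `|s| < d.
  by move/cvgrPdist_lt : cid => /(_ d d0); apply: filterS => s; rewrite sub0r normrN.
apply: filterS near0 => s sd.
rewrite [s *: 1]mulr1.
have [as_ sb _ _] : [/\ a < s + t, s + t < b, `|s + t - t| <= r &
    forall v, `|A (s + t) v - A t v| <= e1 * `|v|] by apply: dt; rewrite addrK.
have sab : a <= s + t <= b by rewrite !ltW.
apply/ler_addgt0Pr => q q0; have q2 : 0 < q / 2 by rewrite divr_gt0.
(* [h] is chosen after [s] and [q], while the neighbourhood of [t] was fixed before it; the error
   [q] of replacing [J] by [Z h] at both ends is arbitrary. *)
have [h [[[[h1 h2] h3] h4] h5]] := dnbhs_ex (dnbhsI (dnbhsI (dnbhsI (dnbhsI BZ (Z_unif q2))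
  is_derive_Z) (DZ_approx e10)) (Z_unif e10)).
rewrite (subr_split (J (s + t)) _ (Z h (s + t)) (Z h t)).
rewrite [X in `|X|]addrAC.
apply: le_trans (ler_normD _ _) _; apply: lerD; last first.
  apply: le_trans (ler_normB _ _) _.
  by rewrite [q]splitr lerD// distrC h2.
pose w x := Z h x - x *: A t (J t).
have -> : Z h (s + t) - Z h t - s *: A t (J t) = w (s + t) - w t.
  rewrite /w scalerDl; move: (Z h (s + t)) (Z h t) (A t (J t)) => u v x.
  by rewrite opprB opprD (addrA u) subrKA addrAC.
rewrite -[X in e * `|X|](addrK t).
apply: (mean_value_ineq_sym (dw := fun x => DZ h x - A t (J t))) => x xst;
    have xt := le_lt_trans (between_dist xst) sd.
  have [ax xb _ _] := dt _ xt; apply: is_deriveB; first by apply: h3; rewrite !ltW.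
  exact: is_derive_scalel.
have [ax xb xr xA] := dt _ xt.
have xab : a <= x <= b by rewrite !ltW.
rewrite -(subrKA (A x (Z h x))).
have -> : A x (Z h x) - A t (J t) = (A x (Z h x) - A t (Z h x)) + A t (Z h x - J t).
  by rewrite linearB addrA subrK.
have ZJ : `|Z h x - J t| <= e1 + K * r.
  rewrite -(subrKA (J x)); apply: le_trans (ler_normD _ _) _.
  by apply: lerD; [exact: h5 | apply: le_trans (JK _ _ xab tab) _; rewrite ler_wpM2l].
have E1 : `|DZ h x - A x (Z h x)| <= e1 by exact: h4.
have E2 : `|A x (Z h x) - A t (Z h x)| <= e1 * B.
  by apply: le_trans (xA _) _; rewrite ler_wpM2l ?h1// ltW.
have E3 : `|A t (Z h x - J t)| <= L * (e1 + K * r).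
  by apply: le_trans (F_bound tab _) _; rewrite ler_wpM2l.
apply: le_trans (ler_normD _ _) _.
apply: le_trans (lerD E1 (le_trans (ler_normD _ _) (lerD E2 E3))) _.
have e1E : e1 * (1 + B + L) = e / 2 by rewrite divfK// gt_eqF.
have rE : r * (L * K + 1) = e / 2 by rewrite divfK// gt_eqF.
nra.
Unshelve. all: by end_near. Qed.

End variational_equation.

(** * Christoffel symbols and Jacobi fields in a chart *)

Lemma derive_linear_comb (R : realType) (n : nat) (W : normedModType R)
    (f : 'rV[R]_n -> W) x e :
  differentiable f x -> 'D_e f x = \sum_i e 0 i *: 'D_(delta_mx 0 i) f x.
Proof.
move=> df; rewrite deriveE// [e in LHS]row_sum_delta linear_sum.
by apply: eq_bigr => i _; rewrite linearZ -deriveE.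
Qed.

Section matrix_valued_maps.
Variable R : realType.
Implicit Types V W : normedModType R.

Lemma is_derive_coord V (m n : nat) (M : V -> 'M[R]_(m, n)) (x v : V) (M' : 'M[R]_(m, n)) i j :
  is_derive x v M M' -> is_derive x v (fun y => M y i j) (M' i j).
Proof.
move=> [dM <-]; split; first by move/derivable_mxP : dM; exact.
by rewrite derive_mx// mxE.
Qed.

Lemma is_derive_mx V (m n : nat) (M : V -> 'M[R]_(m, n)) (x v : V) (M' : 'M[R]_(m, n)) :
  (forall i j, is_derive x v (fun y => M y i j) (M' i j)) -> is_derive x v M M'.
Proof.
move=> dM; have dM' : derivable M x v.
  by apply/derivable_mxP => i j; have [] := dM i j.
split=> //; rewrite derive_mx//; apply/matrixP => i j; rewrite mxE.
by have [] := dM i j.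
Qed.

Lemma is_derive_mul3 V (f g h : V -> R) (x v : V) f' g' h' :
  is_derive x v f f' -> is_derive x v g g' -> is_derive x v h h' ->
  is_derive x v (fun y => f y * g y * h y)
    (f' * g x * h x + f x * g' * h x + f x * g x * h').
Proof.
move=> df dg dh; have D := is_deriveM (is_deriveM df dg) dh.
have -> : f' * g x * h x + f x * g' * h x + f x * g x * h' =
    (f x * g x) *: h' + h x *: (f x *: g' + g x *: f').
  by rewrite /GRing.scale/=; ring.
exact: D.
Qed.

Lemma is_derive_diff_comp V W (g : R -> V) (f : V -> W) (t : R) g' :
  is_derive t 1 g g' -> differentiable f (g t) ->
  is_derive t 1 (f \o g) ('d f (g t) g').
Proof.
move=> [dg <-] df; have dg' : differentiable g t by apply/derivable1_diffP.
split; first by apply/derivable1_diffP; exact: differentiable_comp.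
rewrite deriveE; last exact: differentiable_comp.
by rewrite diff_comp//= (deriveE _ dg').
Qed.

Lemma coord_sdiff V (m n : nat) (M : V -> 'M[R]_(m, n)) (x : V) i j :
  strictly_differentiable M x -> strictly_differentiable (fun y => M y i j) x.
Proof.
move=> sM.
have linc : linear (fun N : 'M[R]_(m, n) => N i j : R).
  by move=> a A B; rewrite !mxE.
pose L : {linear 'M[R]_(m, n) -> R} :=
  HB.pack (fun N : 'M[R]_(m, n) => N i j : R)
    (GRing.isLinear.Build _ _ _ _ (fun N : 'M[R]_(m, n) => N i j : R) linc).
apply: (@sdiff_comp _ _ _ _ M L) => //.
apply: linear_sdiff => N; apply: differentiable_continuous.
exact: differentiable_coord.
Qed.

Lemma sdiff_scalel V W (f : V -> R) (w : W) (x : V) :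
  strictly_differentiable f x -> strictly_differentiable (fun y => f y *: w) x.
Proof.
move=> sf.
have linw : linear (fun a : R => a *: w).
  by move=> a b c; rewrite scalerDl scalerA.
pose L : {linear R -> W} := HB.pack (fun a : R => a *: w)
    (GRing.isLinear.Build _ _ _ _ (fun a : R => a *: w) linw).
apply: (@sdiff_comp _ _ _ _ f L) => //.
apply: linear_sdiff => N; apply: differentiable_continuous.
exact: differentiableZl.
Qed.

Lemma sdiff_row V (n : nat) (f : 'I_n -> V -> R) (x : V) :
  (forall i, strictly_differentiable (f i) x) ->
  strictly_differentiable (fun y => \row_i f i y) x.
Proof.
move=> sf.
have -> : (fun y => \row_i f i y) = (fun y => \sum_i f i y *: delta_mx 0 i).
  by apply/funext => y; rewrite [LHS]row_sum_delta; apply: eq_bigr => i _; rewrite mxE.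
by apply: sdiff_sum => i; exact: sdiff_scalel.
Qed.

Lemma sdiff_prod V (I : Type) (r : seq I) (f : I -> V -> R) x :
  (forall i, strictly_differentiable (f i) x) ->
  strictly_differentiable (fun y => \prod_(i <- r) f i y) x.
Proof.
move=> df; elim: r => [|i r IH].
  by under eq_fun do rewrite big_nil; exact: sdiff_cst.
under eq_fun do rewrite big_cons.
exact: (@sdiffM _ _ (f i) (fun y => \prod_(j <- r) f j y) x (df i) IH).
Qed.

Lemma det_sdiff V (n : nat) (M : V -> 'M[R]_n) (x : V) :
  (forall i j, strictly_differentiable (fun y => M y i j) x) ->
  strictly_differentiable (fun y => \det (M y)) x.
Proof.
move=> sM; rewrite /determinant; apply: sdiff_sum => s.
apply: (@sdiffM _ _ (fun=> (-1) ^+ s) (fun y => \prod_i M y i (s i))).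
  exact: sdiff_cst.
by apply: sdiff_prod => i; exact: sM.
Qed.

(** By Cramer's formula an entry of the inverse is a cofactor divided by the determinant. [invmx]
    agrees with it only on invertible matrices, hence the assumption on a neighbourhood. *)
Lemma invmx_sdiff V (n : nat) (M : V -> 'M[R]_n) (x : V) k l :
  (\near x, M x \in unitmx) -> strictly_differentiable M x ->
  strictly_differentiable (fun y => invmx (M y) k l) x.
Proof.
move=> uM sM; have sMij i j := coord_sdiff i j sM.
pose f y := (\det (M y))^-1 * ((-1) ^+ (l + k) * \det (row' l (col' k (M y)))).
apply: (@near_sdiff _ _ _ f).
  by near=> y; rewrite /f /invmx (near uM y)// !mxE.
apply: (@sdiffM _ _ (fun y => (\det (M y))^-1)
  (fun y => (-1) ^+ (l + k) * \det (row' l (col' k (M y))))).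
  apply: sdiffV; last exact: det_sdiff.
  by have := nbhs_singleton uM; rewrite unitmxE unitfE.
apply: (@sdiffM _ _ (fun=> (-1) ^+ (l + k)) (fun y => \det (row' l (col' k (M y))))).
  exact: sdiff_cst.
apply: det_sdiff => i j; under eq_fun do rewrite !mxE.
exact: sMij.
Unshelve. all: by end_near. Qed.

End matrix_valued_maps.

Section pairs.
Variables (R : realType) (V W : normedModType R).

Let fst_linear : linear (fst : V * W -> V). Proof. by []. Qed.
Let snd_linear : linear (snd : V * W -> W). Proof. by []. Qed.
Let fstL : {linear (V * W)%type -> V} :=
  HB.pack (fst : V * W -> V) (GRing.isLinear.Build _ _ _ _ (fst : V * W -> V) fst_linear).
Let sndL : {linear (V * W)%type -> W} :=
  HB.pack (snd : V * W -> W) (GRing.isLinear.Build _ _ _ _ (snd : V * W -> W) snd_linear).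

Lemma fst_sdiff (x : V * W) : strictly_differentiable (fst : V * W -> V) x.
Proof. by apply: (@linear_sdiff _ _ _ fstL) => y; exact: cvg_fst. Qed.

Lemma snd_sdiff (x : V * W) : strictly_differentiable (snd : V * W -> W) x.
Proof. by apply: (@linear_sdiff _ _ _ sndL) => y; exact: cvg_snd. Qed.

Lemma is_derive_fst (z : R -> V * W) (t : R) z' : is_derive t 1 z z' ->
  is_derive t 1 (fun s => (z s).1) z'.1.
Proof.
move=> dz; have := is_derive_diff_comp dz (fst_sdiff (z t)).1.
by rewrite (@diff_lin _ _ _ fstL)// => y; exact: cvg_fst.
Qed.

Lemma is_derive_snd (z : R -> V * W) (t : R) z' : is_derive t 1 z z' ->
  is_derive t 1 (fun s => (z s).2) z'.2.
Proof.
move=> dz; have := is_derive_diff_comp dz (snd_sdiff (z t)).1.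
by rewrite (@diff_lin _ _ _ sndL)// => y; exact: cvg_snd.
Qed.

Lemma is_derive_pair (f : R -> V) (g : R -> W) (t : R) f' g' :
  is_derive t 1 f f' -> is_derive t 1 g g' ->
  is_derive t 1 (fun s => (f s, g s)) (f', g').
Proof.
move=> [df <-] [dg <-].
have df' : differentiable f t by apply/derivable1_diffP.
have dg' : differentiable g t by apply/derivable1_diffP.
split; first by apply/derivable1_diffP; exact: differentiable_pair.
rewrite deriveE; last exact: differentiable_pair.
by rewrite (diff_pair df' dg')/= -!deriveE.
Qed.

End pairs.

Section bilinear_form.
Variables (R : realType) (n : nat).
Implicit Types (A : 'M[R]_n) (u v w : 'rV[R]_n).

Lemma bilE A u w : bil A u w = \sum_i \sum_j A i j * u 0 i * w 0 j.
Proof.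
rewrite /bil mxE; under eq_bigr => j _ do rewrite !mxE big_distrl.
rewrite exchange_big; apply: eq_bigr => i _; apply: eq_bigr => j _.
by rewrite (mulrC (u 0 i)).
Qed.

Lemma bilDl A u v w : bil A (u + v) w = bil A u w + bil A v w.
Proof. by rewrite /bil !mulmxDl mxE. Qed.

Lemma bilDr A u v w : bil A u (v + w) = bil A u v + bil A u w.
Proof. by rewrite /bil linearD mulmxDr mxE. Qed.

Lemma bilZl A a u w : bil A (a *: u) w = a * bil A u w.
Proof. by rewrite /bil -!scalemxAl mxE. Qed.

Lemma bilZr A a u w : bil A u (a *: w) = a * bil A u w.
Proof. by rewrite /bil linearZ -scalemxAr mxE. Qed.

Lemma bilNl A u w : bil A (- u) w = - bil A u w.
Proof. by rewrite -scaleN1r bilZl mulN1r. Qed.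

Lemma bil0l A w : bil A 0 w = 0.
Proof. by rewrite /bil !mul0mx mxE. Qed.

Lemma bil_sym A u w : A^T = A -> bil A u w = bil A w u.
Proof.
move=> sA; rewrite /bil; have <- : (w *m A *m u^T)^T = u *m A *m w^T.
  by rewrite !trmx_mul trmxK sA mulmxA.
by rewrite mxE.
Qed.

Lemma is_derive_bil (A : R -> 'M[R]_n) (a b : R -> 'rV[R]_n) (t : R) A' a' b' :
  is_derive t 1 A A' -> is_derive t 1 a a' -> is_derive t 1 b b' ->
  is_derive t 1 (fun s => bil (A s) (a s) (b s))
    (bil A' (a t) (b t) + bil (A t) a' (b t) + bil (A t) (a t) b').
Proof.
move=> dA da db; under eq_fun do rewrite bilE.
rewrite !bilE -!big_split /=.
have -> : (fun s => \sum_i \sum_j A s i j * a s 0 i * b s 0 j) =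
  \sum_i (fun s => \sum_j A s i j * a s 0 i * b s 0 j).
  by apply/funext => s; rewrite fct_sumE.
apply: is_derive_sum => i; rewrite -!big_split /=.
have -> : (fun s => \sum_j A s i j * a s 0 i * b s 0 j) =
  \sum_j (fun s => A s i j * a s 0 i * b s 0 j).
  by apply/funext => s; rewrite fct_sumE.
apply: is_derive_sum => j.
have dA' := is_derive_coord i j dA.
have da' := is_derive_coord 0 i da.
have db' := is_derive_coord 0 j db.
exact: is_derive_mul3.
Qed.

End bilinear_form.

(** * Connection, curvature and geodesic field in a chart *)

Section christoffel_symbols.
Variables (R : realType) (n : nat) (G : 'rV[R]_n -> 'M[R]_n) (U : set 'rV[R]_n).
Hypotheses (U_open : open U)
  (G_sdiff : forall x, U x -> strictly_differentiable G x)
  (dG_sdiff : forall x, U x -> forall v, strictly_differentiable ('D_v G) x)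
  (G_sym : forall x, U x -> (G x)^T = G x)
  (G_pos : forall x, U x -> forall u, u != 0 -> 0 < bil (G x) u u).
Implicit Types x a b e X Y Z : 'rV[R]_n.

Local Notation Gamma := (christoffel G).

Let near_U x : U x -> \near x, U x.
Proof. by move=> Ux; apply: open_nbhs_nbhs; split. Qed.

Lemma metric_unit x : U x -> G x \in unitmx.
Proof.
move=> Ux; rewrite -row_free_unit; apply: inj_row_free => v vG.
by apply/eqP; apply: contraT => /(G_pos Ux); rewrite /bil vG mul0mx mxE ltxx.
Qed.

Lemma metric_coefC x i j : U x -> G x i j = G x j i.
Proof. by move=> Ux; rewrite -[in LHS](G_sym Ux) mxE. Qed.

Lemma partial_metricE x i j l : U x ->
  partial i (fun z => G z j l) x = ('D_(delta_mx 0 i) G x) j l.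
Proof.
move=> Ux; rewrite /partial derive_mx ?mxE//.
by apply: diff_derivable; exact: (G_sdiff Ux).1.
Qed.

Lemma partial_metricC x i j l : U x ->
  partial i (fun z => G z j l) x = partial i (fun z => G z l j) x.
Proof.
move=> Ux; apply: near_eq_derive.
by apply: filterS (near_U Ux) => z Uz; rewrite metric_coefC.
Qed.

Lemma christoffel_sdiff k i j x : U x -> strictly_differentiable (Gamma k i j) x.
Proof.
move=> Ux; apply: (@sdiffM _ _ (fun=> 2^-1) (fun y => \sum_(l < n) _)).
  exact: sdiff_cst.
apply: sdiff_sum => l.
apply: (@sdiffM _ _ (fun y => invmx (G y) k l) (fun y => _ + _ - _)).
  apply: invmx_sdiff; last exact: G_sdiff.
  by apply: filterS (near_U Ux) => y; exact: metric_unit.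
have dP (i1 i2 i3 : 'I_n) : strictly_differentiable (partial i1 (fun z => G z i2 i3)) x.
  apply: (@near_sdiff _ _ _ (fun y => ('D_(delta_mx 0 i1) G y) i2 i3)).
    by apply: filterS (near_U Ux) => y Uy; rewrite partial_metricE.
  by apply: coord_sdiff; exact: dG_sdiff.
apply: (@sdiffD _ _ _ (fun y => _ + _) (fun y => - _)).
  by apply: sdiffD; exact: dP.
apply: (@near_sdiff _ _ _ (fun y => -1 * partial l (fun z => G z i j) y)).
  by near=> y; rewrite mulN1r.
by apply: (@sdiffM _ _ (fun=> -1)); [exact: sdiff_cst | exact: dP].
Unshelve. all: by end_near. Qed.

Lemma christoffelC k i j x : U x -> Gamma k i j x = Gamma k j i x.
Proof.
move=> Ux; rewrite /christoffel; congr (_ * _); apply: eq_bigr => l _.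
by rewrite (partial_metricC l i j Ux) [X in _ * (X - _)]addrC.
Qed.

(** Contracting with the metric cancels the inverse matrix and leaves the Christoffel symbol of the
    first kind. *)
Lemma christoffel_lower i j m x : U x ->
  \sum_k Gamma k i j x * G x k m = 2^-1 *
    (partial i (fun z => G z j m) x + partial j (fun z => G z i m) x
     - partial m (fun z => G z i j) x).
Proof.
move=> Ux.
pose S l := partial i (fun z => G z j l) x + partial j (fun z => G z i l) x
     - partial l (fun z => G z i j) x.
have -> : \sum_k Gamma k i j x * G x k m =
    2^-1 * \sum_l (G x *m invmx (G x)) m l * S l.
  rewrite /christoffel; under eq_bigr => k _ do rewrite -mulrA big_distrl/=.
  rewrite -big_distrr/=; congr (_ * _); rewrite exchange_big/=.
  apply: eq_bigr => l _; rewrite mxE big_distrl/=; apply: eq_bigr => k _.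
  by rewrite (metric_coefC k m Ux) -/(S l); ring.
rewrite mulmxV; last exact: metric_unit.
rewrite (bigD1 m)//= big1 ?addr0 ?mxE ?eqxx ?mul1r// => l lm.
by rewrite mxE eq_sym (negPf lm) mul0r.
Qed.

Lemma partial_metric_christoffel (e i j : 'I_n) x : U x ->
  partial e (fun z => G z i j) x =
  \sum_k Gamma k e i x * G x k j + \sum_k Gamma k e j x * G x k i.
Proof.
move=> Ux; rewrite !christoffel_lower//.
by rewrite (partial_metricC e j i Ux); field.
Qed.

(** With the indices contracted, the covariant derivative of [Y] along a curve [x] reads
    [Y' + christoffel_form x x' Y], and the geodesic equation [x'' = - christoffel_form x x' x']. *)
Definition christoffel_form x a b : 'rV[R]_n :=
  \row_k \sum_i \sum_j Gamma k i j x * a 0 i * b 0 j.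

Definition christoffel_derivative x e a b : 'rV[R]_n :=
  \row_k \sum_i \sum_j 'D_e (Gamma k i j) x * a 0 i * b 0 j.

Local Notation chr := christoffel_form.
Local Notation dchr := christoffel_derivative.

Lemma christoffel_formC x a b : U x -> chr x a b = chr x b a.
Proof.
move=> Ux; apply/rowP => k; rewrite !mxE exchange_big/=.
by apply: eq_bigr => i _; apply: eq_bigr => j _; rewrite (christoffelC k j i Ux) mulrAC.
Qed.

Lemma christoffel_derivativeC x e a b : U x -> dchr x e a b = dchr x e b a.
Proof.
move=> Ux; apply/rowP => k; rewrite !mxE exchange_big/=.
apply: eq_bigr => i _; apply: eq_bigr => j _.
have -> : 'D_e (Gamma k j i) x = 'D_e (Gamma k i j) x; last exact: mulrAC.
apply: near_eq_derive; apply: filterS (near_U Ux) => y Uy.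
exact: christoffelC.
Qed.

Lemma christoffel_formDr x a b (c : 'rV[R]_n) : chr x a (b + c) = chr x a b + chr x a c.
Proof.
apply/rowP => k; rewrite !mxE -big_split; apply: eq_bigr => i _.
rewrite -big_split; apply: eq_bigr => j _ /=.
by rewrite !mxE mulrDr.
Qed.

Lemma christoffel_formZr x a l b : chr x a (l *: b) = l *: chr x a b.
Proof.
apply/rowP => k; rewrite !mxE big_distrr; apply: eq_bigr => i _ /=.
rewrite big_distrr; apply: eq_bigr => j _ /=.
by rewrite !mxE mulrCA.
Qed.

Lemma christoffel_formNr x a b : chr x a (- b) = - chr x a b.
Proof. by rewrite -scaleN1r christoffel_formZr scaleN1r. Qed.

Let bil_chr x a b (c : 'rV[R]_n) : bil (G x) (chr x a b) c =
  \sum_i \sum_j \sum_l (\sum_k Gamma k i j x * G x k l) * a 0 i * b 0 j * c 0 l.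
Proof.
rewrite bilE.
under eq_bigr => k _.
  under eq_bigr => l _.
    rewrite mxE big_distrr/= big_distrl/=.
    under eq_bigr => i _ do rewrite big_distrr/= big_distrl/=.
    over.
  rewrite exchange_big/=.
  under eq_bigr => i _ do rewrite exchange_big/=.
  over.
rewrite exchange_big/=; apply: eq_bigr => i _.
rewrite exchange_big/=; apply: eq_bigr => j _.
rewrite exchange_big/=; apply: eq_bigr => l _.
rewrite 3!big_distrl/=; apply: eq_bigr => k _; ring.
Qed.

(** This is the vanishing of the covariant derivative of the metric, obtained from the coordinate
    identity by linearity in [e], [a] and [b]. *)
Lemma metric_compatible x e a b : U x ->
  bil ('D_e G x) a b = bil (G x) (chr x e a) b + bil (G x) a (chr x e b).
Proof.
move=> Ux; rewrite [bil (G x) a _]bil_sym ?G_sym// !bil_chr.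
rewrite [bil _ a b]bilE (derive_linear_comb _ (G_sdiff Ux).1).
under eq_bigr => i _.
  under eq_bigr => j _ do rewrite summxE 2!big_distrl/=.
  rewrite exchange_big/=; over.
rewrite exchange_big/= -big_split; apply: eq_bigr => m _ /=.
rewrite [X in _ = _ + X]exchange_big/=.
rewrite -big_split; apply: eq_bigr => i _ /=.
rewrite -big_split; apply: eq_bigr => j _ /=.
rewrite mxE -partial_metricE// partial_metric_christoffel//; ring.
Qed.

Lemma is_derive_christoffel_form (X a b : R -> 'rV[R]_n) (t : R) X' a' b' :
  U (X t) -> is_derive t 1 X X' -> is_derive t 1 a a' -> is_derive t 1 b b' ->
  is_derive t 1 (fun s => chr (X s) (a s) (b s))
    (dchr (X t) X' (a t) (b t) + chr (X t) a' (b t) + chr (X t) (a t) b').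
Proof.
move=> UX dX da db; apply: is_derive_mx => i k; rewrite !mxE.
under eq_fun do rewrite mxE.
rewrite -!big_split/=.
have -> : (fun s => \sum_i \sum_j Gamma k i j (X s) * a s 0 i * b s 0 j) =
  \sum_i (fun s => \sum_j Gamma k i j (X s) * a s 0 i * b s 0 j).
  by apply/funext => s; rewrite fct_sumE.
apply: is_derive_sum => l; rewrite -!big_split/=.
have -> : (fun s => \sum_j Gamma k l j (X s) * a s 0 l * b s 0 j) =
  \sum_j (fun s => Gamma k l j (X s) * a s 0 l * b s 0 j).
  by apply/funext => s; rewrite fct_sumE.
apply: is_derive_sum => j; apply: is_derive_mul3.
- have [dG _] := christoffel_sdiff k l j UX.
  by rewrite deriveE//; exact: is_derive_diff_comp.
- exact: (is_derive_coord 0 l da).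
- exact: (is_derive_coord 0 j db).
Qed.

Let dchrE x X Y Z l : U x -> dchr x X Y Z 0 l =
  \sum_i \sum_j \sum_k partial i (Gamma l j k) x * X 0 i * Y 0 j * Z 0 k.
Proof.
move=> Ux; rewrite mxE.
under eq_bigr => j _.
  under eq_bigr => k _.
    rewrite (derive_linear_comb _ (christoffel_sdiff l j k Ux).1) 2!big_distrl/=.
    over.
  rewrite exchange_big/=; over.
rewrite exchange_big/=; apply: eq_bigr => i _; apply: eq_bigr => j _.
by apply: eq_bigr => k _; rewrite /partial /GRing.scale/=; ring.
Qed.

Let chr_chrE x X Y Z l : chr x X (chr x Y Z) 0 l =
  \sum_i \sum_j \sum_k (\sum_m Gamma m j k x * Gamma l i m x) *
    X 0 i * Y 0 j * Z 0 k.
Proof.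
rewrite mxE; apply: eq_bigr => i _.
under eq_bigr => m _.
  rewrite mxE big_distrr/=.
  under eq_bigr => j _ do rewrite big_distrr/=.
  over.
rewrite exchange_big/=; apply: eq_bigr => j _.
rewrite exchange_big/=; apply: eq_bigr => k _.
rewrite 3!big_distrl/=; apply: eq_bigr => m _; ring.
Qed.

(** The curvature evaluated on fields with constant components: their brackets vanish, and each
    covariant derivative contributes one Christoffel form and the derivative of the other. *)
Lemma curvatureE x X Y Z : U x -> curvature G x X Y Z =
  dchr x X Y Z - dchr x Y X Z + chr x X (chr x Y Z) - chr x Y (chr x X Z).
Proof.
move=> Ux; apply/rowP => l.
have rowE (A B C D : 'rV[R]_n) :
  (A - B + C - D) 0 l = A 0 l - B 0 l + C 0 l - D 0 l by rewrite !mxE.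
rewrite rowE [LHS]mxE.
rewrite !dchrE// !chr_chrE.
rewrite [\sum_i \sum_j \sum_k partial i (Gamma l j k) x * Y 0 i * _ * _]exchange_big/=.
rewrite [\sum_i \sum_j \sum_k _ * Y 0 i * X 0 j * _]exchange_big/=.
rewrite -!sumrN -!big_split/=; apply: eq_bigr => i _.
rewrite -!sumrN -!big_split/=; apply: eq_bigr => j _.
rewrite -!sumrN -!big_split/=; apply: eq_bigr => k _.
rewrite /curvature_coef sumrB.
move: (partial i (Gamma l j k) x) (partial j (Gamma l i k) x).
move: (\sum_m Gamma m j k x * Gamma l i m x) (\sum_m Gamma m i k x * Gamma l j m x).
by move=> s1 s2 p1 p2; ring.
Qed.

Lemma bil_cauchy_schwarz x X Y : U x -> row_free (col_mx X Y) ->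
  0 < bil (G x) X X * bil (G x) Y Y - bil (G x) X Y ^+ 2.
Proof.
move=> Ux /row_freeP[B XYB].
have free (a b : R) : a *: X + b *: Y = 0 -> a = 0 /\ b = 0.
  move=> ab0; have : row_mx a%:M b%:M *m col_mx X Y = 0.
    by rewrite mul_row_col !mul_scalar_mx.
  move/(congr1 (mulmx^~ B)); rewrite -mulmxA XYB mulmx1 mul0mx => /eqP.
  rewrite -row_mx0 => /eqP/eq_row_mx[/matrixP/(_ 0 0) + /matrixP/(_ 0 0)].
  by rewrite !mxE/= !mulr1n.
have Y0 : Y != 0.
  apply/eqP => Y0; have : 0 *: X + 1 *: Y = 0 by rewrite scale0r scale1r Y0 addr0.
  by move=> /free[_ /eqP]; rewrite oner_eq0.
have gY := G_pos Ux Y0.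
(* The part of [X] orthogonal to [Y], scaled to avoid a division; its square norm is [bil (G x) Y Y]
   times the Gram determinant. *)
set w := bil (G x) Y Y *: X + (- bil (G x) X Y) *: Y.
have w0 : w != 0.
  by apply/eqP => /free[/eqP]; rewrite gt_eqF.
have := G_pos Ux w0.
have -> : bil (G x) w w = bil (G x) Y Y *
    (bil (G x) X X * bil (G x) Y Y - bil (G x) X Y ^+ 2).
  rewrite /w !(bilDl, bilDr, bilZl, bilZr) (bil_sym Y X (G_sym Ux)).
  ring.
by rewrite pmulr_rgt0.
Qed.

(** The sectional curvature bound concerns independent vectors only, but a Jacobi field may be
    parallel to the velocity. In the dependent case [R(X, Y)Y] is zero by antisymmetry. *)
Lemma curvature_nonpos x X Y : U x ->
  (row_free (col_mx X Y) -> sectional_curvature G x X Y <= 0) ->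
  bil (G x) (curvature G x X Y Y) X <= 0.
Proof.
move=> Ux; have [XYf /(_ isT)|XYf _] := boolP (row_free (col_mx X Y)).
  have D := bil_cauchy_schwarz Ux XYf.
  by rewrite /sectional_curvature pmulr_lle0// invr_gt0.
suff -> : curvature G x X Y Y = 0 by rewrite bil0l.
have [->|Y0] := eqVneq Y 0.
  apply/rowP => l; rewrite !mxE big1// => i _; rewrite big1// => j _.
  by rewrite big1// => k _; rewrite !mxE !mulr0.
have [c ->] : exists c, X = c *: Y.
  apply: contrapT => XY; move/negP: XYf; apply; apply: inj_row_free => v.
  rewrite -[v]hsubmxK mul_row_col [lsubmx v]mx11_scalar [rsubmx v]mx11_scalar.
  rewrite !mul_scalar_mx; set a := lsubmx v 0 0; set b := rsubmx v 0 0 => ab0.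
  have [a0|a0] := eqVneq a 0.
    move: ab0; rewrite a0 scale0r add0r => /eqP.
    by rewrite scaler_eq0 (negPf Y0) orbF => /eqP ->; rewrite !raddf0 row_mx0.
  exfalso; apply: XY; exists (- (b / a)).
  apply: (scalerI a0); rewrite scalerA mulrN mulrCA mulfV// mulr1 scaleNr.
  by apply/eqP; rewrite -addr_eq0 ab0.
have coefN l i j k : curvature_coef G l j i k x = - curvature_coef G l i j k x.
  rewrite /curvature_coef !sumrB.
  move: (partial i (Gamma l j k) x) (partial j (Gamma l i k) x).
  move: (\sum_m Gamma m j k x * Gamma l i m x) (\sum_m Gamma m i k x * Gamma l j m x).
  by move=> s1 s2 p1 p2; ring.
apply/rowP => l; rewrite [RHS]mxE.
have : curvature G x (c *: Y) Y Y 0 l = - curvature G x (c *: Y) Y Y 0 l.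
  rewrite [LHS]mxE [in RHS]mxE [LHS]exchange_big/= -sumrN; apply: eq_bigr => i _.
  rewrite -sumrN; apply: eq_bigr => j _; rewrite -sumrN; apply: eq_bigr => k _.
  by rewrite coefN !mxE; ring.
by move=> E; lra.
Qed.

(** The geodesic spray: as a first-order system on position and velocity, the geodesic equation
    falls under the variational equation above. *)
Definition geodesic_field (z : 'rV[R]_n * 'rV[R]_n) : 'rV[R]_n * 'rV[R]_n :=
  (z.2, geodesic_acceleration G z.1 z.2).

Lemma geodesic_accelerationE x u : geodesic_acceleration G x u = - chr x u u.
Proof. by apply/rowP => k; rewrite !mxE. Qed.

Lemma geodesic_field_sdiff z : U z.1 -> strictly_differentiable geodesic_field z.
Proof.
move=> Uz; apply: sdiff_pair; first exact: snd_sdiff.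
apply: (@sdiff_row _ _ n (fun k (z : 'rV[R]_n * 'rV[R]_n) => _)) => k.
apply: (@near_sdiff _ _ _ (fun z : 'rV[R]_n * 'rV[R]_n =>
    -1 * \sum_i \sum_j Gamma k i j z.1 * z.2 0 i * z.2 0 j)).
  by near=> y; rewrite mulN1r.
apply: (@sdiffM _ _ (fun=> -1)); first exact: sdiff_cst.
apply: sdiff_sum => i; apply: sdiff_sum => j.
apply: (@sdiffM _ _ (fun z : 'rV[R]_n * 'rV[R]_n => Gamma k i j z.1 * z.2 0 i)
  (fun z => z.2 0 j)).
  apply: (@sdiffM _ _ (fun z : 'rV[R]_n * 'rV[R]_n => Gamma k i j z.1)
    (fun z => z.2 0 i)).
    by apply: sdiff_comp; [exact: fst_sdiff | exact: christoffel_sdiff].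
  by apply: coord_sdiff; exact: snd_sdiff.
by apply: coord_sdiff; exact: snd_sdiff.
Unshelve. all: by end_near. Qed.

(** Differentiability being known, the value of the differential at [w] is read off along the line
    [z + s w], where the product rule for Christoffel forms applies. *)
Lemma diff_geodesic_field z w : U z.1 -> 'd geodesic_field z w =
  (w.2, - (dchr z.1 w.1 z.2 z.2 + chr z.1 w.2 z.2 + chr z.1 z.2 w.2)).
Proof.
case: z w => [x u] [J K] /= Ux.
have lin (a b : 'rV[R]_n) : is_derive (0 : R) 1 (fun s : R => a + s *: b) b.
  apply: is_derive_eq (is_deriveD (is_derive_cst _ _ _) (is_derive_scalel _ _)) _.
  by rewrite add0r.
pose g (s : R) := (x + s *: J, u + s *: K).
have dg : is_derive (0 : R) 1 g (J, K) by apply: is_derive_pair; exact: lin.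
have g0 : g 0 = (x, u) by rewrite /g !scale0r !addr0.
have Ug0 : U (g 0).1 by rewrite g0.
have dF := (geodesic_field_sdiff Ug0).1.
have [_ E1] := is_derive_diff_comp dg dF.
have gx := is_derive_fst dg; have gu := is_derive_snd dg.
have dchr_g := is_derive_christoffel_form Ug0 gx gu gu.
have [_ E2] := is_derive_pair gu (is_deriveN dchr_g).
have {}E2 : 'D_1 (geodesic_field \o g) 0 = (K, - (dchr (g 0).1 J (g 0).2 (g 0).2 +
    chr (g 0).1 K (g 0).2 + chr (g 0).1 (g 0).2 K)).
  rewrite -E2; have -> // : geodesic_field \o g =
    fun s => ((g s).2, (- (fun s => chr (g s).1 (g s).2 (g s).2)) s).
  by apply/funext => s; rewrite /= /geodesic_field geodesic_accelerationE.
have : 'd geodesic_field (g 0) (J, K) = (K, - (dchr (g 0).1 J (g 0).2 (g 0).2 +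
    chr (g 0).1 K (g 0).2 + chr (g 0).1 (g 0).2 K)) by rewrite -E1 E2.
by rewrite g0.
Qed.

(** With [K + chr x u J] as covariant derivative of [J], the left side is the derivative of its
    product with [J], expanded by the product rule and [metric_compatible]. The Christoffel terms
    collapse to the curvature: this is the Jacobi equation paired with [J]. *)
Let jacobi_identity x u J K : U x ->
  bil (G x) (chr x u (K + chr x u J)) J + bil (G x) (K + chr x u J) (chr x u J)
  + bil (G x) (- (dchr x J u u + chr x K u + chr x u K) +
      (dchr x u u J + chr x (- chr x u u) J + chr x u K)) J
  + bil (G x) (K + chr x u J) K =
  bil (G x) (K + chr x u J) (K + chr x u J) - bil (G x) (curvature G x J u u) J.
Proof.
move=> Ux; have curvE : chr x u (K + chr x u J) +
    (- (dchr x J u u + chr x K u + chr x u K) +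
      (dchr x u u J + chr x (- chr x u u) J + chr x u K)) = - curvature G x J u u.
  rewrite curvatureE// christoffel_formDr (christoffel_formC (- _) J Ux).
  rewrite christoffel_formNr (christoffel_formC K u Ux) (christoffel_formC J u Ux).
  rewrite (christoffel_derivativeC u u J Ux).
  move: (chr x u K) (chr x u (chr x u J)) (chr x J (chr x u u)) => a b c.
  move: (dchr x J u u) (dchr x u J u) => d e.
  by apply/rowP => i; rewrite !mxE; ring.
have -> : bil (G x) (curvature G x J u u) J =
    - (bil (G x) (chr x u (K + chr x u J)) J + bil (G x)
      (- (dchr x J u u + chr x K u + chr x u K) +
       (dchr x u u J + chr x (- chr x u u) J + chr x u K)) J).
  by rewrite -bilDl curvE bilNl opprK.
rewrite (bilDr (G x) (K + chr x u J) K); ring.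
Qed.

(** * Derivatives of the squared norm of a Jacobi field *)

Section jacobi_field.
Variables (z Jf : R -> 'rV[R]_n * 'rV[R]_n) (t : R).
Hypotheses (Uz : U (z t).1)
  (z_geodesic : is_derive t 1 z (geodesic_field (z t)))
  (Jf_jacobi : is_derive t 1 Jf ('d geodesic_field (z t) (Jf t))).

(** The second component of [Jf] is the coordinate derivative of the first; the Christoffel term
    makes it the covariant derivative along the geodesic. *)
Let W s := (Jf s).2 + chr (z s).1 (z s).2 (Jf s).1.

Let dx : is_derive t 1 (fun s => (z s).1) (z t).2.
Proof. exact: is_derive_fst z_geodesic. Qed.

Let du : is_derive t 1 (fun s => (z s).2) (- chr (z t).1 (z t).2 (z t).2).
Proof.
by rewrite -geodesic_accelerationE; exact: is_derive_snd z_geodesic.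
Qed.

Let dJ : is_derive t 1 (fun s => (Jf s).1) (Jf t).2.
Proof. by have := is_derive_fst Jf_jacobi; rewrite diff_geodesic_field. Qed.

Let dK : is_derive t 1 (fun s => (Jf s).2) (- (dchr (z t).1 (Jf t).1 (z t).2 (z t).2
  + chr (z t).1 (Jf t).2 (z t).2 + chr (z t).1 (z t).2 (Jf t).2)).
Proof. by have := is_derive_snd Jf_jacobi; rewrite diff_geodesic_field. Qed.

Let dG : is_derive t 1 (fun s => G (z s).1) ('D_((z t).2) G (z t).1).
Proof.
have dGx := (G_sdiff Uz).1.
by rewrite deriveE//; exact: is_derive_diff_comp.
Qed.

Lemma is_derive_jacobi_norm : is_derive t 1
  (fun s => bil (G (z s).1) (Jf s).1 (Jf s).1)
  (2 * bil (G (z t).1) (W t) (Jf t).1).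
Proof.
apply: is_derive_eq (is_derive_bil dG dJ dJ) _.
rewrite metric_compatible// /W bilDl.
rewrite (bil_sym (Jf t).1 (chr _ _ _) (G_sym Uz)) (bil_sym (Jf t).1 (Jf t).2 (G_sym Uz)).
ring.
Qed.

Lemma is_derive_jacobi_norm2 : is_derive t 1
  (fun s => bil (G (z s).1) (W s) (Jf s).1)
  (bil (G (z t).1) (W t) (W t)
   - bil (G (z t).1) (curvature G (z t).1 (Jf t).1 (z t).2 (z t).2) (Jf t).1).
Proof.
have dW := is_deriveD dK (is_derive_christoffel_form Uz dx du dJ).
apply: is_derive_eq (is_derive_bil dG dW dJ) _.
by rewrite metric_compatible// /W jacobi_identity.
Qed.

End jacobi_field.

End christoffel_symbols.

(** * Geodesics in charts *)

Lemma Ck1_sdiff (R : realType) (n : nat) (W : normedModType R)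
    (U : set 'rV[R]_n) (f : 'rV[R]_n -> W) x :
  open U -> Ck 1 U f -> U x -> strictly_differentiable f x.
Proof.
move=> oU [_ Cf] Ux; apply: partial_sdiff.
  have : \near x, U x by apply: open_nbhs_nbhs; split.
  by apply: filterS => y Uy i; have [/(_ y Uy)] := Cf (delta_mx 0 i).
by move=> i; have [_ [/(_ x Ux)]] := Cf (delta_mx 0 i).
Qed.

Lemma lipschitz_diff (R : realType) (V W : normedModType R) (f : V -> W) x L v :
  differentiable f x -> (\forall y \near x, `|f y - f x| <= L * `|y - x|) ->
  `|'d f x v| <= L * `|v|.
Proof.
move=> df Lf; apply/ler_addgt0Pr => e e0.
have Lh : \forall h \near (0 : R), `|f (h *: v + x) - f x| <= L * `|h *: v|.
  have cx : h *: v + x @[h --> (0 : R)] --> x.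
    rewrite -[X in _ --> X]add0r -(scale0r v).
    by apply: cvgD; [apply: cvgZr_tmp; exact: cvg_id | exact: cvg_cst].
  have H : \forall h \near (0 : R), `|f (h *: v + x) - f x| <= L * `|h *: v + x - x|.
    exact: cx Lf.
  by apply: filterS H => h; rewrite addrK.
have : \forall h \near (0 : R), `|f (h *: v + x) - f x| <= L * `|h *: v| /\
    `|f (h *: v + x) - f x - h *: 'D_v f x| <= e * `|h|.
  by apply: filterI Lh _; apply: derivable_expansion => //; exact: diff_derivable.
move=> /nbhs_ballP[d /= d0 Hd]; have h0 : 0 < d / 2 by rewrite divr_gt0.
have [E1] : `|f ((d / 2) *: v + x) - f x| <= L * `|(d / 2) *: v| /\
    `|f ((d / 2) *: v + x) - f x - (d / 2) *: 'D_v f x| <= e * `|d / 2|.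
  apply: Hd; rewrite -ball_normE /= sub0r normrN gtr0_norm//.
  by rewrite ltr_pdivrMr// ltr_pMr// ltr1n.
rewrite deriveE//; move: (f _ - f x) E1 => D.
rewrite normrZ (gtr0_norm h0) => E1 E2.
rewrite -(ler_pM2l h0) -[X in X * _ <= _](gtr0_norm h0) -normrZ.
rewrite -[X in `|X|](subrK D); apply: le_trans (ler_normD _ _) _.
by rewrite mulrDr mulrCA addrC [_ * e]mulrC lerD// distrC.
Qed.

Lemma near_dist_lt (R : realType) (V : normedModType R) (x y : V) (q : R) :
  `|x - y| < q -> \forall z \near y, `|x - z| < q.
Proof.
move=> xy; apply/nbhs_ballP; exists (q - `|x - y|) => /=; first by rewrite subr_gt0.
move=> z; rewrite -ball_normE /= => yz; rewrite -(subrKA y).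
by apply: le_lt_trans (ler_normD _ _) _; rewrite -ltrBrDl.
Qed.

Lemma quarter_bounds (R : realType) (q : R) : 0 < q ->
  [/\ 0 < q / 4, q / 4 < q, q / 4 + q / 4 < q, q / 8 < q / 4 & 2 * (q / 8) = q / 4].
Proof. by move=> q0; split; lra. Qed.

Lemma half_bound (R : realType) (x : R) : x <= 4^-1 -> 2 * x <= 2^-1.
Proof. by move=> x4; lra. Qed.

Lemma itv_length (R : realType) (t0 d a b : R) :
  t0 - d <= a -> b <= t0 + d -> b - a <= 2 * d.
Proof. by move=> ? ?; lra. Qed.

Lemma norm_pair_lt (R : realType) (V W : normedModType R) (x y : V * W) (q : R) :
  `|x.1 - y.1| < q -> `|x.2 - y.2| < q -> `|x - y| < q.
Proof. by move=> x1 x2; rewrite [ltLHS]/Num.norm/= gt_max x1. Qed.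

Lemma norm_fst_le (R : realType) (V W : normedModType R) (x y : V * W) :
  `|x.1 - y.1| <= `|x - y|.
Proof. by rewrite [leRHS]/Num.norm/= le_max lexx. Qed.

Lemma near_left (R : realType) (a t : R) (Q : R -> Prop) : a < t ->
  (\forall s \near t, Q s) -> exists2 s, a <= s < t & Q s.
Proof.
move=> at_ /nbhs_ballP[d /= d0 Hd]; exists (Num.max a (t - d / 2)).
  by rewrite le_max lexx gt_max at_ ltrBlDr ltrDl divr_gt0.
have d2 : d / 2 < d by rewrite ltr_pdivrMr// ltr_pMr// ltr1n.
apply: Hd; rewrite -ball_normE /= ger0_norm.
  by rewrite ltrBlDr -ltrBlDl lt_max ltrD2l ltrN2 d2 orbT.
by rewrite subr_ge0 ge_max ltW//= gerBl divr_ge0// ltW.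
Qed.

Lemma left_continuous_le (R : realType) (V : normedModType R) (f : R -> V)
    (a t E : R) : a < t -> {for t, continuous f} ->
  (forall s, a <= s < t -> `|f s| <= E) -> `|f t| <= E.
Proof.
move=> at_ ft fE; apply/ler_addgt0Pr => e e0.
move/cvgrPdist_le : ft => /(_ e e0)/(near_left at_)[s st fts].
rewrite -[f t](subrK (f s)); apply: le_trans (ler_normD _ _) _.
by rewrite addrC lerD// fE.
Qed.

Lemma compact_closed_ball (R : realType) (n : nat) (x : 'rV[R]_n) (r : R) :
  0 < r -> compact (closed_ball_ (fun y => `|y|) x r).
Proof.
move=> r0; apply: bounded_closed_compact; last first.
  by rewrite -closed_ballE//; exact: closed_ball_closed.
exists (`|x| + r); split; first by rewrite num_real.
move=> N xN y /= xy; apply: le_trans (ltW xN).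
rewrite -[y](subrK x) addrC; apply: le_trans (ler_normD _ _) _.
by rewrite lerD2l distrC.
Qed.

(** The window around [t] accepts any starting time [t1] in its left half: started before [t] it
    reaches [t], started at [t] it goes beyond. One local statement thus provides both steps of the
    induction. *)
Lemma propagation (R : realType) (S : R -> Prop) : S 0 ->
  (forall t, 0 <= t -> exists2 d, 0 < d & forall t1, 0 <= t1 ->
     t - d <= t1 <= t -> S t1 -> forall s, t1 <= s <= t + d -> S s) ->
  forall t, 0 <= t -> S t.
Proof.
move=> S0 prop T T0; apply: (@real_induction _ 0 T S T0 S0) => [t|t|].
- move=> /andP[t0 _] St; have [d d0 Hd] := prop t (ltW t0).
  pose t1 := Num.max 0 (t - d).
  have t1t : t1 < t by rewrite gt_max t0 ltrBlDr ltrDl.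
  apply: (Hd t1).
  - by rewrite le_max lexx.
  - by rewrite le_max lexx orbT ltW.
  - by apply: St; rewrite t1t le_max lexx.
  - by rewrite ltW// lerDl ltW.
- move=> /andP[t0 _] St; have [d d0 Hd] := prop t t0.
  near=> s => ts; apply: (Hd t) => //.
    by rewrite lexx andbT gerBl ltW.
  rewrite ltW//= ltW//; near: s; apply: lt_nbhsl.
  by rewrite ltrDl.
- by rewrite T0 lexx.
Unshelve. all: by end_near. Qed.

Section charts.
Variables (R : realType) (n : nat) (M : smooth_manifold R n).
Variable g : riemannian_metric M.
Implicit Types (c d : chart M) (gam : R -> M) (t : R).

Local Notation image c := (chart_map c @` chart_dom c).

Lemma metric_sdiff c x : image c x -> strictly_differentiable (g c) x.
Proof. exact: (Ck1_sdiff (@chart_image_open R n M c) (@metric_smooth R n M g c 1%N)). Qed.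

Lemma dmetric_sdiff c x : image c x ->
  forall v, strictly_differentiable ('D_v (g c)) x.
Proof.
move=> cx v; have [_ /(_ v)[_]] := @metric_smooth R n M g c 2%N.
by move/(Ck1_sdiff (@chart_image_open R n M c)); exact.
Qed.

Lemma metric_mx_sym c x : image c x -> (g c x)^T = g c x.
Proof. by case=> y cy <-; exact: Defs.metric_sym. Qed.

Lemma metric_mx_pos c x : image c x -> forall u, u != 0 -> 0 < bil (g c x) u u.
Proof. by case=> y cy <-; exact: Defs.metric_pos. Qed.

Lemma chart_injective c x y : chart_dom c x -> chart_dom c y ->
  chart_map c x = chart_map c y -> x = y.
Proof. by move=> cx cy E; rewrite -(chart_mapK cx) E chart_mapK. Qed.

Definition transition c d := chart_map d \o param c.

Lemma chart_overlap_open c d : open (chart_map c @` (chart_dom c `&` chart_dom d)).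
Proof.
rewrite openE => _ [x [cx dx] <-].
have ix : \forall y \near chart_map c x, image c y.
  by apply: open_nbhs_nbhs; split; [exact: chart_image_open | exists x].
have px : \forall y \near chart_map c x, chart_dom d (param c y).
  apply: (param_continuous cx); rewrite chart_mapK//.
  by apply: open_nbhs_nbhs; split; [exact: chart_dom_open|].
near=> y; have [z cz zy] : image c y by near: y.
exists z => //; split=> //; rewrite -(chart_mapK cz) zy.
by near: y.
Unshelve. all: by end_near. Qed.

Lemma transition_sdiff c d x : chart_dom c x -> chart_dom d x ->
  strictly_differentiable (transition c d) (chart_map c x) /\
  forall v, strictly_differentiable ('D_v (transition c d)) (chart_map c x).
Proof.
move=> cx dx; have ox := @chart_overlap_open c d.
have x_in : (chart_map c @` (chart_dom c `&` chart_dom d)) (chart_map c x).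
  by exists x.
split; first exact: (Ck1_sdiff ox (@transition_smooth R n M c d 1%N)).
move=> v; have [_ /(_ v)[_]] := @transition_smooth R n M c d 2%N.
by move/(Ck1_sdiff ox); exact.
Qed.

Definition state c gam t : 'rV[R]_n * 'rV[R]_n :=
  (chart_map c (gam t), derive1 (chart_map c \o gam) t).

Lemma near_chart_dom c gam t : geodesic g gam -> chart_dom c (gam t) ->
  \forall s \near t, chart_dom c (gam s).
Proof.
move=> [gc _] cg; apply: (gc t).
by apply: open_nbhs_nbhs; split; [exact: chart_dom_open|].
Qed.

Lemma state_is_derive c gam t : geodesic g gam -> chart_dom c (gam t) ->
  is_derive t 1 (state c gam) (geodesic_field (g c) (state c gam t)).
Proof.
move=> [_ gg] cg; have [d1 d2 E] := gg t c cg; apply: is_derive_pair.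
  by split; [exact: d1 | rewrite -derive1E].
by split; [exact: d2 | rewrite -derive1E; exact: E].
Qed.

Lemma state_continuous c gam t : geodesic g gam -> chart_dom c (gam t) ->
  {for t, continuous (state c gam)}.
Proof. by move=> gg cg; exact: is_derive1_continuous (state_is_derive gg cg). Qed.

Lemma chart_field_sdiff c z : image c z.1 ->
  strictly_differentiable (geodesic_field (g c)) z.
Proof.
apply: geodesic_field_sdiff; [exact: chart_image_open | exact: metric_sdiff |
  exact: dmetric_sdiff | exact: metric_mx_pos].
Qed.

Lemma velocity_change c d gam t : geodesic g gam ->
  chart_dom c (gam t) -> chart_dom d (gam t) ->
  (state d gam t).2 =
    'D_((state c gam t).2) (transition c d) (state c gam t).1.
Proof.
move=> gg cg dg; have [tau _] := transition_sdiff cg dg.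
have [dx _ _] := gg.2 t c cg.
rewrite deriveE; last exact: tau.1.
have dx' : is_derive t 1 (chart_map c \o gam) (state c gam t).2.
  by split; [exact: dx | rewrite -derive1E].
have [_ <-] := is_derive_diff_comp dx' tau.1.
rewrite /= derive1E; apply: near_eq_derive.
near=> s; rewrite /transition /= chart_mapK//; near: s.
exact: near_chart_dom.
Unshelve. all: by end_near. Qed.

Lemma state_stable c gam gam' (B : set ('rV[R]_n * 'rV[R]_n)) L a b :
  geodesic g gam -> geodesic g gam' -> a <= b -> 0 <= L -> L * (b - a) <= 2^-1 ->
  (forall z z', B z -> B z' ->
     `|geodesic_field (g c) z - geodesic_field (g c) z'| <= L * `|z - z'|) ->
  (forall t, a <= t <= b -> [/\ chart_dom c (gam t), chart_dom c (gam' t),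
     B (state c gam t) & B (state c gam' t)]) ->
  `|state c gam' b - state c gam b| <= 2 * `|state c gam' a - state c gam a|.
Proof.
move=> gg gg' ab L0 Lab BL in_B.
rewrite -[X in 2 * X]addr0 -(mul0r (b - a)).
apply: (short_gronwall (w := fun t => state c gam' t - state c gam t)
  (dw := fun t => geodesic_field (g c) (state c gam' t)
                  - geodesic_field (g c) (state c gam t)) ab L0 Lab) => //.
- move=> t /in_B[ct ct' _ _].
  by apply: is_deriveB; exact: state_is_derive.
- by move=> t /in_B[_ _ Bt Bt']; rewrite addr0; exact: BL.
- by rewrite ab lexx.
Qed.

(** While [gam] is in the chart, Gronwall keeps its state close to that of [gam0]. It cannot leave
    the chart either: its coordinates remain in a compact ball inside the chart image, and the image
    of that ball under [param c] is closed because [M] is Hausdorff. *)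
Lemma trapping c gam0 t0 : geodesic g gam0 -> chart_dom c (gam0 t0) ->
  exists d L r : R, [/\ 0 < d, 0 < L, 0 < r & L * (2 * d) <= 2^-1] /\
  [/\ forall t, t0 - d <= t <= t0 + d -> chart_dom c (gam0 t),
      forall t, t0 - d <= t <= t0 + d -> forall v,
        `|'d (geodesic_field (g c)) (state c gam0 t) v| <= L * `|v| &
      forall gam, geodesic g gam -> forall t1, t0 - d <= t1 <= t0 + d ->
        chart_dom c (gam t1) -> `|state c gam t1 - state c gam0 t1| < r ->
        forall t, t1 <= t <= t0 + d -> chart_dom c (gam t) /\
          `|state c gam t - state c gam0 t| <=
          2 * `|state c gam t1 - state c gam0 t1|].
Proof.
move=> gg0 cg0; set z0 := state c gam0 t0; set F := geodesic_field (g c).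
have iz0 : image c z0.1 by exists (gam0 t0).
have [L L0 FL] := sdiff_lipschitz (chart_field_sdiff iz0).
have [q q0 Hq] : exists2 q, 0 < q & forall z, `|z0 - z| < q -> image c z.1 /\
    forall z', `|z0 - z'| < q -> `|F z - F z'| <= L * `|z - z'|.
  have [[B1 B2] [/= B1z B2z] BF] := FL.
  have imz : \forall z \near z0, image c z.1.
    apply: (@cvg_fst _ _ (nbhs z0.1) (nbhs z0.2)).
    by apply: open_nbhs_nbhs; split; [exact: chart_image_open | exact: iz0].
  have : \forall z \near z0, [/\ image c z.1, B1 z & B2 z].
    by near=> z; split; near: z.
  move=> /nbhs_ballP[q q0]; rewrite -ball_normE => qB; exists q => // z /qB[iz B1z' _].
  by split=> // z' /qB[_ _ B2z']; exact: (BF (z, z')).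
have [q4 q4q q44 q84 q8] := quarter_bounds q0.
have [d1 d10 Hd1] : exists2 d1, 0 < d1 & forall t, `|t0 - t| < d1 ->
    chart_dom c (gam0 t) /\ `|z0 - state c gam0 t| < q / 4.
  have near1 := near_chart_dom gg0 cg0.
  have near2 : \forall t \near t0, `|z0 - state c gam0 t| < q / 4.
    by move/cvgrPdist_lt : (state_continuous gg0 cg0); exact.
  have : \forall t \near t0, chart_dom c (gam0 t) /\ `|z0 - state c gam0 t| < q / 4.
    by near=> t; split; near: t.
  by move=> /nbhs_ballP[d1 d10]; rewrite -ball_normE; exists d1.
(* Half of [d1] makes closed time bounds strict; [4^-1 / L] gives the Gronwall condition on the
   whole window of length [2 * d]. *)
pose d := Num.min (d1 / 2) (4^-1 / L).
have d0 : 0 < d by rewrite lt_min !divr_gt0.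
have dd1 : d < d1.
  by rewrite (@le_lt_trans _ _ (d1 / 2)) ?ge_min ?lexx// ltr_pdivrMr// ltr_pMr// ltr1n.
have Ld : L * (2 * d) <= 2^-1.
  have : d <= 4^-1 / L by rewrite ge_min lexx orbT.
  rewrite ler_pdivlMr// => dL; have -> : L * (2 * d) = 2 * (d * L) by ring.
  exact: half_bound.
have in_d t : t0 - d <= t <= t0 + d ->
    chart_dom c (gam0 t) /\ `|z0 - state c gam0 t| < q / 4.
  move=> /andP[t1 t2]; apply: Hd1; apply: le_lt_trans dd1.
  by rewrite distrC ler_distl t1 t2.
(* Gronwall doubles an initial gap below [q / 8], which stays under [q / 4]; with the [q / 4]
   between [gam0] and [z0], the state of [gam] remains well within the ball of radius [q]. *)
exists d, L, (q / 8); split; [by split; rewrite ?divr_gt0 | split].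
- by move=> t /in_d[].
- move=> t /in_d[_ ztq] v.
  have ztq' := lt_trans ztq q4q.
  have [it FLt] := Hq _ ztq'.
  apply: lipschitz_diff; first exact: (chart_field_sdiff it).1.
  have : \forall z \near state c gam0 t, `|z0 - z| < q.
    exact: near_dist_lt.
  by apply: filterS => z zq; rewrite distrC [X in _ * X]distrC; exact: FLt.
move=> gam gg t1 t1d cg1 close1 T.
pose P t := chart_dom c (gam t) /\ `|state c gam t - state c gam0 t| < q / 4.
pose B : set ('rV[R]_n * 'rV[R]_n) := [set z | `|z0 - z| < q].
have lipB z z' : B z -> B z' -> `|F z - F z'| <= L * `|z - z'|.
  by move=> Bz Bz'; have [_] := Hq _ Bz; apply.
have PB t : t0 - d <= t <= t0 + d -> P t -> [/\ chart_dom c (gam0 t), chart_dom c (gam t),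
     B (state c gam0 t) & B (state c gam t)].
  move=> /in_d[c0 ztq] [ct Pt]; split => //; rewrite /B/=; first exact: lt_trans ztq q4q.
  rewrite -(subrKA (state c gam0 t)); apply: le_lt_trans (ler_normD _ _) _.
  by rewrite [X in _ + X]distrC; exact: lt_trans (ltrD ztq Pt) q44.
have stable t : t1 <= t <= t0 + d -> (forall s, t1 <= s <= t -> P s) ->
    `|state c gam t - state c gam0 t| <= 2 * `|state c gam t1 - state c gam0 t1|.
  move=> /andP[t1t td] Pt; move: t1d => /andP[t1d1 t1d2].
  apply: (state_stable (B := B) (L := L)) => //; first exact: ltW.
    by apply: le_trans Ld; rewrite ler_pM2l//; exact: itv_length t1d1 td.
  move=> s /andP[s1 s2]; apply: PB; first by rewrite (le_trans t1d1 s1) (le_trans s2 td).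
  by apply: Pt; rewrite s1 s2.
have e1q : 2 * `|state c gam t1 - state c gam0 t1| < q / 4.
  by rewrite -q8 ltr_pM2l.
have main : forall t, t1 <= t <= t0 + d -> P t.
  case/andP: (t1d) => t1d1 t1d2.
  apply: real_induction => //.
  - by split; [exact: cg1 | exact: lt_trans close1 q84].
  - move=> t /andP[t1t td] Pt.
    pose K : set 'rV[R]_n := closed_ball_ (fun x => `|x|) z0.1 (q / 4 + q / 4).
    have q44' : 0 < q / 4 + q / 4 by rewrite addr_gt0.
    have K_image : K `<=` image c.
      move=> y Ky; have yq : `|z0 - (y, z0.2)| < q.
        by apply: norm_pair_lt; rewrite /= ?subrr ?normr0//; exact: le_lt_trans Ky q44.
      by have [] := Hq _ yq.
    have K_compact : compact K by exact: compact_closed_ball.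
    have cK : closed (param c @` K).
      apply: compact_closed; first exact: manifold_hausdorff.
      apply: continuous_compact => //; apply: continuous_in_subspaceT => y.
      rewrite inE => /K_image[x cx <-]; exact: param_continuous.
    have gam_K s : t1 <= s < t -> (param c @` K) (gam s).
      move=> st; have [cs Ps] := Pt s st; exists (chart_map c (gam s)); last first.
        exact: chart_mapK.
      have [_ sq] : chart_dom c (gam0 s) /\ `|z0 - state c gam0 s| < q / 4.
        by apply: in_d; move: st => /andP[s1 s2]; rewrite (le_trans t1d1 s1) ltW// (lt_le_trans s2).
      apply: le_trans (norm_fst_le z0 (state c gam s)) _.
      rewrite -(subrKA (state c gam0 s)); apply: le_trans (ler_normD _ _) _.
      by rewrite [X in _ + X]distrC; exact: lerD (ltW sq) (ltW Ps).
    have ct : chart_dom c (gam t).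
      have : (param c @` K) (gam t).
        apply: cK => A /(gg.1 t) At.
        by have [s st As] := near_left t1t At; exists (gam s); split; [exact: gam_K|].
      by move=> [y /K_image[x cx <-] <-]; rewrite chart_mapK.
    have [c0t _] : chart_dom c (gam0 t) /\ `|z0 - state c gam0 t| < q / 4.
      by apply: in_d; rewrite (le_trans t1d1 (ltW t1t)).
    split; [exact: ct | apply: le_lt_trans e1q].
    apply: (left_continuous_le (f := fun s => state c gam s - state c gam0 s) t1t).
      by apply: cvgB; exact: state_continuous.
    move=> s /andP[s1 s2]; apply: stable; first by rewrite s1 ltW// (lt_le_trans s2).
    by move=> r /andP[r1 r2]; apply: Pt; rewrite r1 (le_lt_trans r2).
  - move=> t /andP[t1t td] [ct Pt].
    have [c0t _] : chart_dom c (gam0 t) /\ `|z0 - state c gam0 t| < q / 4.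
      by apply: in_d; rewrite (le_trans t1d1 t1t) ltW.
    have nD : (fun s => `|state c gam s - state c gam0 s|) @ t -->
        `|state c gam t - state c gam0 t|.
      by apply: cvg_norm; apply: cvgB; exact: state_continuous.
    have near1 := near_chart_dom gg ct.
    have near2 : \forall s \near t, `|state c gam s - state c gam0 s| < q / 4.
      exact: cvgr_lt nD _ Pt.
    by near=> s => _; split; near: s.
move=> TI; split; first by have [] := main T TI.
apply: stable => // s /andP[s1 s2]; apply: main; move: TI => /andP[_ Td].
by rewrite s1 (le_trans s2).
Unshelve. all: by end_near. Qed.

End charts.

(** * Uniqueness and rescaling of geodesics *)

Section geodesics.
Variables (R : realType) (n : nat) (M : smooth_manifold R n).
Variable g : riemannian_metric M.
Implicit Types (c d : chart M) (gam : R -> M) (t : R).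

Lemma state_change c d gam gam' t : geodesic g gam -> geodesic g gam' ->
  chart_dom c (gam t) -> chart_dom d (gam t) -> gam t = gam' t ->
  state c gam t = state c gam' t -> state d gam t = state d gam' t.
Proof.
move=> gg gg' ct dt E Ec.
have ct' : chart_dom c (gam' t) by rewrite -E.
have dt' : chart_dom d (gam' t) by rewrite -E.
have E1 : (state d gam t).1 = (state d gam' t).1 by rewrite /= E.
have E2 : (state d gam t).2 = (state d gam' t).2.
  by rewrite (velocity_change gg ct dt) (velocity_change gg' ct' dt') Ec.
by rewrite (surjective_pairing (state d gam t)) E1 E2.
Qed.

(** Equal states are an initial gap 0 in [trapping], hence gap 0 across the window. Equality is
    asserted in every chart, so that each window can use its own. *)
Lemma geodesic_unique p v gam gam' : geodesic_from g p v gam ->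
  geodesic_from g p v gam' -> forall t, 0 <= t -> gam t = gam' t.
Proof.
move=> [gg gam0 dgam] [gg' gam'0 dgam'] t t0.
pose S t := gam t = gam' t /\ forall c, chart_dom c (gam t) -> state c gam t = state c gam' t.
suff : S t by case.
apply: propagation t0.
  split=> [|c c0]; first by rewrite gam0 gam'0.
  have p0 : chart_dom (chart_at p) (gam 0) by rewrite gam0; exact: chart_at_dom.
  apply: (state_change gg gg' p0 c0); first by rewrite gam0 gam'0.
  by rewrite /state gam0 gam'0 dgam dgam'.
move=> {}t t0; have ct := chart_at_dom (gam t).
have [d [L [r [[d0 L0 r0 _] [dom _ trap]]]]] := trapping gg ct.
exists d => // t1 _ /andP[t1d t1t] [E1 S1] s s12.
have t1d' : t - d <= t1 <= t + d by rewrite t1d (le_trans t1t)// lerDl ltW.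
have ct1 := dom t1 t1d'.
have c's u : t1 <= u <= t + d ->
    chart_dom (chart_at (gam t)) (gam' u) /\
    state (chart_at (gam t)) gam' u = state (chart_at (gam t)) gam u.
  move=> u12; have := trap gam' gg' t1 t1d'.
  rewrite -E1 (S1 _ ct1) subrr normr0 => /(_ ct1 r0 u u12)[cu].
  by rewrite mulr0 normr_le0 subr_eq0 => /eqP.
have cs : chart_dom (chart_at (gam t)) (gam s).
  by apply: dom; case/andP: s12 => s1 ->; rewrite (le_trans t1d).
have [c's1 Es] := c's s s12.
have E : gam s = gam' s by apply: (chart_injective cs c's1); have [] := Es.
by split; [exact: E | move=> d' d's; exact: (state_change gg gg' cs)].
Qed.

Lemma is_derive_scale_arg (W : normedModType R) (f : R -> W) (r t : R) :
  derivable f (r * t) 1 ->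
  is_derive t 1 (fun s => f (r * s)) (r *: derive1 f (r * t)).
Proof.
move=> df; have dr : is_derive t 1 (fun s : R => r * s) r.
  apply: is_derive_eq (is_deriveM (is_derive_cst r t 1) (is_derive_id t 1)) _.
  by rewrite scaler0 addr0 [r *: 1]mulr1.
have df' : differentiable f (r * t) by apply/derivable1_diffP.
have D := is_derive_diff_comp dr df'.
by rewrite (deriv1E df) in D.
Qed.

Lemma geodesic_acceleration_scale c (x u : 'rV[R]_n) (r : R) :
  geodesic_acceleration (g c) x (r *: u) =
  r *: (r *: geodesic_acceleration (g c) x u).
Proof.
apply/rowP => k; rewrite !mxE !mulrN !big_distrr/=; congr (- _).
apply: eq_bigr => i _; rewrite !big_distrr/=; apply: eq_bigr => j _.
by rewrite !mxE; ring.
Qed.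

(** The acceleration is quadratic in the velocity, which matches the factor [r ^ 2] of the second
    derivative. *)
Lemma geodesic_scale p v gam r : geodesic_from g p v gam ->
  geodesic_from g p (r *: v) (fun t => gam (r * t)).
Proof.
move=> [gg g0 dg].
have D1 t c : chart_dom c (gam (r * t)) ->
    is_derive t 1 (fun s => chart_map c (gam (r * s)))
      (r *: derive1 (chart_map c \o gam) (r * t)).
  by move=> ct; have [d1 _ _] := gg.2 _ _ ct; exact: is_derive_scale_arg d1.
have D1E t c : chart_dom c (gam (r * t)) ->
    derive1 (fun s => chart_map c (gam (r * s))) t =
    r *: derive1 (chart_map c \o gam) (r * t).
  by move=> /D1[_ <-]; rewrite derive1E.
have rc t : (fun s => r * s) @ t --> r * t by exact: mulrl_continuous.
split; [split|by rewrite mulr0|].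
- move=> t; apply: (@continuous_comp _ _ _ (fun s => r * s) gam); first exact: rc.
  exact: gg.1.
- move=> t c ct x; have [d1 d2 E] := gg.2 _ _ ct.
  have D2 : is_derive t 1 (derive1 x)
      (r *: (r *: derive1 (derive1 (chart_map c \o gam)) (r * t))).
    have near_c : \forall s \near t, chart_dom c (gam (r * s)).
      exact: rc (near_chart_dom gg ct).
    apply: (@near_eq_is_derive _ _ _ (fun s => r *: derive1 (chart_map c \o gam) (r * s))).
      by apply: filterS near_c => s cs; rewrite -D1E.
    by apply: is_deriveZ; exact: is_derive_scale_arg.
  split; first by have [] := D1 _ _ ct.
    by have [] := D2.
  have -> : derive1 (derive1 x) t = r *: (r *: derive1 (derive1 (chart_map c \o gam)) (r * t)).
    by have [_ <-] := D2; rewrite derive1E.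
  by rewrite E /= D1E// geodesic_acceleration_scale.
- have p0 : chart_dom (chart_at p) (gam (r * 0)) by rewrite mulr0 g0; exact: chart_at_dom.
  by rewrite -[LHS]/(derive1 (fun s => chart_map (chart_at p) (gam (r * s))) 0) D1E// mulr0 dg.
Qed.

(** [exp_map] selects a value at time 1 by choice; uniqueness identifies it with that of the
    rescaled geodesic. *)
Lemma exp_mapE p v gam r : geodesic_from g p v gam -> 0 <= r ->
  exp_map g p (r *: v) = gam r.
Proof.
move=> gv r0; have gr := geodesic_scale r gv.
rewrite /exp_map; case: xgetP => [q _ [gam' g' <-]|/(_ (gam (r * 1)))[]].
  by rewrite (geodesic_unique g' gr)// mulr1.
by exists (fun t => gam (r * t)).
Qed.

End geodesics.

(** * Variations of geodesics *)

Lemma prod_cauchy_cvg (R : realType) (n : nat)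
    (F : set_system (('rV[R]_n * 'rV[R]_n)%type : normedModType R)) :
  ProperFilter F -> cauchy F -> cvg F.
Proof.
move=> PF /cauchyP cF.
have c1 : cvg ((fst : 'rV[R]_n * 'rV[R]_n -> 'rV[R]_n) @ F).
  apply: cauchy_cvg; apply/cauchyP => e e0; have [x Fx] := cF e e0.
  exists x.1; suff : F [set y | ball x.1 e y.1] by [].
  apply: filterS Fx => y; rewrite -!ball_normE /=.
  exact: le_lt_trans (norm_fst_le x y).
have c2 : cvg ((snd : 'rV[R]_n * 'rV[R]_n -> 'rV[R]_n) @ F).
  apply: cauchy_cvg; apply/cauchyP => e e0; have [x Fx] := cF e e0.
  exists x.2; suff : F [set y | ball x.2 e y.2] by [].
  apply: filterS Fx => y; rewrite -!ball_normE /=.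
  by apply: le_lt_trans; rewrite [leRHS]/Num.norm/= le_max lexx orbT.
apply/cvg_ex; exists (lim ((fst : 'rV[R]_n * 'rV[R]_n -> 'rV[R]_n) @ F),
  lim ((snd : 'rV[R]_n * 'rV[R]_n -> 'rV[R]_n) @ F)).
have -> : F = ((fun z : 'rV[R]_n * 'rV[R]_n => (z.1, z.2)) @ F).
  by apply/funext => A; congr (F _); apply/funext => -[].
exact: cvg_pair c1 c2.
Qed.

(** States change chart by the tangent map of the transition. Its second component is the linear
    combination of partial derivatives where [f] is differentiable, hence the assumption near
    [z.1]. *)
Lemma tangent_map_sdiff (R : realType) (n m : nat) (f : 'rV[R]_n -> 'rV[R]_m)
    (z : 'rV[R]_n * 'rV[R]_n) :
  (\forall y \near z.1, differentiable f y) -> strictly_differentiable f z.1 ->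
  (forall v, strictly_differentiable ('D_v f) z.1) ->
  strictly_differentiable
    (fun z : 'rV[R]_n * 'rV[R]_n => (f z.1, 'D_(z.2) f z.1)) z.
Proof.
move=> df sf sdf.
apply: (@sdiff_pair _ _ _ _ (fun z : 'rV[R]_n * 'rV[R]_n => f z.1)
    (fun z => 'D_(z.2) f z.1)).
  by apply: sdiff_comp sf; exact: fst_sdiff.
apply: (@near_sdiff _ _ _ (fun z : 'rV[R]_n * 'rV[R]_n =>
    \row_k \sum_i z.2 0 i * ('D_(delta_mx 0 i) f z.1) 0 k)).
  have df' : \forall y \near z, differentiable f y.1.
    exact: (@cvg_fst _ _ (nbhs z.1) (nbhs z.2) _ _ df).
  apply: filterS df' => y dfy; rewrite (derive_linear_comb _ dfy).
  by apply/rowP => k; rewrite mxE summxE; apply: eq_bigr => i _; rewrite mxE.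
apply: (@sdiff_row _ _ m (fun k (z : 'rV[R]_n * 'rV[R]_n) => _)) => k.
apply: sdiff_sum => i.
apply: (@sdiffM _ _ (fun z : 'rV[R]_n * 'rV[R]_n => z.2 0 i)
  (fun z => ('D_(delta_mx 0 i) f z.1) 0 k)).
  by apply: coord_sdiff; exact: snd_sdiff.
apply: (@coord_sdiff _ _ _ _ (fun z : 'rV[R]_n * 'rV[R]_n => 'D_(delta_mx 0 i) f z.1)).
by apply: sdiff_comp (sdf _); exact: fst_sdiff.
Qed.

Section variation.
Variables (R : realType) (n : nat) (M : smooth_manifold R n).
Variable g : riemannian_metric M.
Implicit Types (c d : chart M) (t : R).

Lemma near_transition_differentiable c d x : chart_dom c x -> chart_dom d x ->
  \forall y \near chart_map c x, differentiable (transition c d) y.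
Proof.
move=> cx dx; have : \forall y \near chart_map c x,
    (chart_map c @` (chart_dom c `&` chart_dom d)) y.
  apply: open_nbhs_nbhs; split; first exact: chart_overlap_open.
  by exists x.
apply: filterS => _ [z [cz dz] <-]; exact: (transition_sdiff cz dz).1.1.
Qed.

Variable gamv : R -> R -> M.
Hypothesis gamv_geodesic : forall h, geodesic g (gamv h).

(** [chart_map c] is arbitrary off the chart domain, so derivability alone would say nothing about
    the geodesics. *)
Definition varies c t : Prop :=
  (\forall h \near (0 : R), chart_dom c (gamv h t)) /\
  derivable (fun h => state c (gamv h) t) 0 1.

Definition variation c t : 'rV[R]_n * 'rV[R]_n :=
  'D_1 (fun h => state c (gamv h) t) 0.

Lemma varies_change c d t : chart_dom c (gamv 0 t) -> chart_dom d (gamv 0 t) ->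
  varies c t -> varies d t.
Proof.
move=> c0 d0 [ch dch].
have dch' : differentiable (fun h => state c (gamv h) t) 0 by apply/derivable1_diffP.
have cch : chart_map c (gamv h t) @[h --> (0 : R)] --> chart_map c (gamv 0 t).
  exact: (differentiable_continuous (differentiable_comp dch' (fst_sdiff _).1)).
(* Nothing is assumed on [h |-> gamv h t] as a map into [M]; its continuity at 0 is recovered from
   the coordinates through [param c]. *)
have dh : \forall h \near (0 : R), chart_dom d (gamv h t).
  have : \forall h \near (0 : R), chart_dom d (param c (chart_map c (gamv h t))).
    have pd : \forall y \near chart_map c (gamv 0 t), chart_dom d (param c y).
      apply: (param_continuous c0); rewrite chart_mapK//.
      by apply: open_nbhs_nbhs; split; [exact: chart_dom_open|].
    exact: cch pd.
  by apply: filterS2 ch => h ch; rewrite chart_mapK.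
split; first exact: dh.
apply: (@near_eq_derivable _ _ _ (fun h : R => (transition c d (state c (gamv h) t).1,
    'D_((state c (gamv h) t).2) (transition c d) (state c (gamv h) t).1))).
  near=> h; have ct : chart_dom c (gamv h t) by near: h.
  have dt : chart_dom d (gamv h t) by near: h.
  rewrite -(velocity_change (gamv_geodesic h) ct dt) /transition /=; congr (_, _).
  by rewrite chart_mapK.
apply/derivable1_diffP.
have [ts dts] := transition_sdiff c0 d0.
have sT := @tangent_map_sdiff _ _ _ (transition c d) (state c (gamv 0) t)
  (near_transition_differentiable c0 d0) ts dts.
exact: (differentiable_comp dch' sT.1).
Unshelve. all: by end_near. Qed.

(** [trapping] around the central geodesic supplies every hypothesis of the variational equation on
    [[t1, t0 + e]], with stability constant 2. *)
Lemma local_variation t0 : exists2 e, 0 < e &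
  let c := chart_at (gamv 0 t0) in
  (forall t, t0 - e <= t <= t0 + e -> chart_dom c (gamv 0 t)) /\
  forall t1, t0 - e <= t1 <= t0 -> varies c t1 ->
  [/\ forall t, t1 <= t <= t0 + e -> varies c t,
      forall t, t1 < t < t0 + e -> is_derive t 1 (variation c)
        ('d (geodesic_field (g c)) (state c (gamv 0) t) (variation c t)) &
      exists2 K, 0 <= K & forall s t, t1 <= s <= t0 + e -> t1 <= t <= t0 + e ->
        `|variation c s - variation c t| <= K * `|s - t| ].
Proof.
pose c := chart_at (gamv 0 t0).
have ct0 : chart_dom c (gamv 0 t0) by exact: chart_at_dom.
have [e [L [r [[e0 L0 r0 Le] [dom bd trap]]]]] := trapping (gamv_geodesic 0) ct0.
exists e; first exact: e0.
rewrite /= -/c; split; first exact: dom.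
move=> t1 /andP[t1l t1r] [ct1 dt1].
have t1e : t0 - e <= t1 <= t0 + e by rewrite t1l (le_trans t1r)// lerDl ltW.
have t1e' : t1 <= t0 + e by case/andP: t1e.
have dt1' : differentiable (fun h => state c (gamv h) t1) 0 by apply/derivable1_diffP.
have near1 : \forall h \near (0 : R), `|state c (gamv h) t1 - state c (gamv 0) t1| < r.
  have : (fun h => state c (gamv h) t1) @ (0 : R) --> state c (gamv 0) t1.
    exact: (differentiable_continuous dt1').
  by move/cvgrPdistC_lt; apply.
have stay : \forall h \near (0 : R), forall t, t1 <= t <= t0 + e ->
    chart_dom c (gamv h t) /\ `|state c (gamv h) t - state c (gamv 0) t| <=
      2 * `|state c (gamv h) t1 - state c (gamv 0) t1|.
  by apply: filterS2 ct1 near1 => h; exact: (trap _ (gamv_geodesic h) t1 t1e).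
have in_e t : t1 <= t <= t0 + e -> t0 - e <= t <= t0 + e.
  by move=> /andP[t1t ->]; rewrite (le_trans t1l).
have zD : \forall h \near (0 : R), forall t, t1 <= t <= t0 + e ->
    is_derive t 1 (state c (gamv h)) (geodesic_field (g c) (state c (gamv h) t)).
  by apply: filterS stay => h Hh t /Hh[ct _]; exact: state_is_derive.
have zS : \forall h \near (0 : R), forall t, t1 <= t <= t0 + e ->
    `|state c (gamv h) t - state c (gamv 0) t| <=
      2 * `|state c (gamv h) t1 - state c (gamv 0) t1|.
  by apply: filterS stay => h Hh t /Hh[].
have Fs t : t1 <= t <= t0 + e ->
    strictly_differentiable (geodesic_field (g c)) (state c (gamv 0) t).
  by move=> /in_e/dom ct; apply: chart_field_sdiff; exists (gamv 0 t).
have Fb t : t1 <= t <= t0 + e -> forall v,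
    `|'d (geodesic_field (g c)) (state c (gamv 0) t) v| <= L * `|v|.
  by move=> /in_e/bd.
have Ll : L * (t0 + e - t1) <= 2^-1.
  by apply: le_trans Le; rewrite ler_pM2l//; exact: itv_length t1l (lexx _).
have ler02 : (0 : R) <= 2 by [].
split.
- move=> t t1t; split; first by apply: filterS stay => h /(_ t t1t)[].
  exact: (variation_derivable (@prod_cauchy_cvg R n) t1e' (ltW L0) Ll ler02 zD Fs Fb zS dt1 t1t).
- move=> t t1t.
  exact: (variation_is_derive (@prod_cauchy_cvg R n) t1e' (ltW L0) Ll ler02 zD Fs Fb zS dt1 t1t).
- exact: (variation_lipschitz (@prod_cauchy_cvg R n) t1e' (ltW L0) Ll ler02 zD Fs Fb zS dt1).
Qed.

Lemma varies_all : (forall c, chart_dom c (gamv 0 0) -> varies c 0) ->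
  forall t, 0 <= t -> forall c, chart_dom c (gamv 0 t) -> varies c t.
Proof.
move=> v0; apply: propagation; first exact: v0.
move=> t t0.
have [e e0 [dom H]] := local_variation t.
exists e; first exact: e0.
move=> t1 _ t1t S1 s s1 c cs.
have s1' : t - e <= s <= t + e.
  by case/andP: t1t s1 => t1l _ /andP[t1s ->]; rewrite (le_trans t1l).
have cs' := dom s s1'.
apply: (varies_change cs' cs).
have t1' : t - e <= t1 <= t + e.
  by case/andP: t1t => -> t1r; rewrite (le_trans t1r)// lerDl ltW.
by have [+ _ _] := H t1 t1t (S1 _ (dom _ t1')); exact.
Qed.

End variation.

(** * The polar metric *)

Lemma cvg_sum (R : realType) (T I : Type) (r : seq I) (F : set_system T)
    (FF : Filter F) (f : I -> T -> R) (a : I -> R) :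
  (forall i, f i @ F --> a i) -> (fun s => \sum_(i <- r) f i s) @ F --> \sum_(i <- r) a i.
Proof.
move=> fa; elim: r => [|i r IH].
  by under eq_fun do rewrite big_nil; rewrite big_nil; exact: cvg_cst.
under eq_fun do rewrite big_cons; rewrite big_cons.
by apply: cvgD; [exact: fa | exact: IH].
Qed.

Lemma derive_line (R : realType) (V W : normedModType R) (f : V -> W) (x v : V) :
  'D_v f x = 'D_1 (fun h : R => f (x + h *: v)) 0.
Proof.
rewrite /derive.
have -> : (fun h : R => h^-1 *: ((f \o shift x) (h *: v) - f x)) =
  (fun h => h^-1 *: (((fun h : R => f (x + h *: v)) \o shift 0) (h *: (1 : R))
    - f (x + 0 *: v))) => //.
by apply/funext => h; rewrite /= [h *: 1]mulr1 addr0 scale0r addr0 [x + _]addrC.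
Qed.

Section radial_expansion.
Variables (R : realType) (n : nat) (M : smooth_manifold R n).
Variable g : riemannian_metric M.
Hypothesis curv : nonpositive_sectional_curvature g.
Variables (p : M) (v X : 'rV[R]_n) (gamv : R -> R -> M).
Hypothesis gamv_from : forall h, geodesic_from g p (v + h *: X) (gamv h).
Hypothesis X_neq0 : X != 0.
Implicit Types (c d : chart M) (t : R).

Let gamv_geodesic h : geodesic g (gamv h).
Proof. by have [] := gamv_from h. Qed.

Let gamv0 h : gamv h 0 = p. Proof. by have [] := gamv_from h. Qed.

Local Notation z c := (state c (gamv 0)).
Local Notation J c := (variation gamv c).

Let initial_state h :
  state (chart_at p) (gamv h) 0 = (chart_map (chart_at p) p, v + h *: X).
Proof. by have [_ _ E] := gamv_from h; rewrite /state gamv0 E. Qed.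

Let is_derive_initial : is_derive (0 : R) 1 (fun h => state (chart_at p) (gamv h) 0) (0, X).
Proof.
under eq_fun do rewrite initial_state.
apply: (@is_derive_pair _ _ _ (cst (chart_map (chart_at p) p)) (fun h => v + h *: X)).
apply: is_derive_eq (is_deriveD (is_derive_cst _ _ _) (is_derive_scalel _ _)) _.
by rewrite add0r.
Qed.

Let varies_initial c : chart_dom c (gamv 0 0) -> varies gamv c 0.
Proof.
move=> c0; have p0 : chart_dom (chart_at p) (gamv 0 0).
  by rewrite gamv0; exact: chart_at_dom.
apply: (varies_change gamv_geodesic p0 c0); split.
  by near=> h; rewrite gamv0; exact: chart_at_dom.
by have [] := is_derive_initial.
Unshelve. all: by end_near. Qed.

Let variation_initial : J (chart_at p) 0 = (0, X).
Proof. by have [_] := is_derive_initial. Qed.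

Let varies_pos t : 0 <= t -> forall c, chart_dom c (gamv 0 t) -> varies gamv c t.
Proof. exact: (varies_all gamv_geodesic varies_initial). Qed.

Let variation_is_derive_fst c t : varies gamv c t ->
  is_derive (0 : R) 1 (fun h => chart_map c (gamv h t)) (J c t).1.
Proof.
move=> [_ dc]; have D : is_derive (0 : R) 1 (fun h => state c (gamv h) t) (J c t) by split.
exact: (is_derive_fst D).
Qed.

Let variation_change c d t : varies gamv c t -> varies gamv d t ->
  chart_dom c (gamv 0 t) -> chart_dom d (gamv 0 t) ->
  (J d t).1 = 'D_((J c t).1) (transition c d) (chart_map c (gamv 0 t)).
Proof.
move=> vc vd c0 d0; have [ts _] := transition_sdiff c0 d0.
have [_ Ed] := variation_is_derive_fst vd.
have [_ E] := is_derive_diff_comp (variation_is_derive_fst vc) ts.1.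
apply: etrans (esym Ed) _; apply: etrans (etrans _ E) (esym (deriveE _ ts.1)).
apply: near_eq_derive.
by apply: filterS vc.1 => h ch; rewrite /transition /= chart_mapK.
Qed.

(** Along [v + h *: X] the exponential is [gamv h r], so its derivative is the variation field. The
    metric transformation law then replaces the preferred chart, which changes with [r], by a chart
    [c] fixed on an interval. *)
Lemma polar_metricE c r : 0 <= r -> chart_dom c (gamv 0 r) ->
  polar_metric g p r v X X =
  bil (g c (z c r).1) (J c r).1 (J c r).1.
Proof.
move=> r0 c0; have expE h : exp_map g p (r *: (v + h *: X)) = gamv h r.
  exact: exp_mapE.
have exp0 : exp_map g p (r *: v) = gamv 0 r.
  by rewrite -expE scale0r addr0.
rewrite /polar_metric exp0; set d := chart_at (gamv 0 r).
have d0 : chart_dom d (gamv 0 r) by exact: chart_at_dom.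
have vc := varies_pos r0 c0; have vd := varies_pos r0 d0.
have -> : 'D_X (fun w => chart_map d (exp_map g p (r *: w))) v = (J d r).1.
  have [_ Ed] := variation_is_derive_fst vd; apply: etrans Ed.
  apply: etrans (derive_line _ _ _) _.
  apply: (congr1 (fun f : R -> 'rV[R]_n => 'D_1 f (0 : R))).
  by apply/funext => h; rewrite expE.
have E := variation_change vc vd c0 d0.
apply: (etrans (congr2 (metric_at g (gamv 0 r)) E E)).
exact: esym (metric_change g c0 d0 (J c r).1 (J c r).1).
Qed.

(** [phi] is the squared norm of the Jacobi field, free of any chart; [psi], half of its derivative,
    is computed in a chart from the covariant derivative [W]. *)
Let phi r := polar_metric g p r v X X.
Let W c s := (J c s).2 + christoffel_form (g c) (z c s).1 (z c s).2 (J c s).1.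
Let psi c s := bil (g c (z c s).1) (W c s) (J c s).1.

(** The lower bound keeps the square norm of [W] and not just its sign: this gives strict growth of
    [psi] near 0. *)
Lemma polar_metric_is_derive c a b : 0 <= a ->
  (forall t, a < t < b -> chart_dom c (gamv 0 t)) ->
  (forall t, a < t < b -> is_derive t 1 (J c)
    ('d (geodesic_field (g c)) (z c t) (J c t))) ->
  forall t, a < t < b -> is_derive t 1 phi (2 * psi c t) /\
  exists2 D, is_derive t 1 (psi c) D & bil (g c (z c t).1) (W c t) (W c t) <= D.
Proof.
move=> a0 dom dJ t tab; have ct := dom t tab.
have iz : (chart_map c @` chart_dom c) (z c t).1 by exists (gamv 0 t).
have zt := state_is_derive (gamv_geodesic 0) ct.
have io := @chart_image_open R n M c.
have ms := @metric_sdiff R n M g c; have dms := @dmetric_sdiff R n M g c.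
have sym := @metric_mx_sym R n M g c; have pos := @metric_mx_pos R n M g c.
split.
  apply: near_eq_is_derive (is_derive_jacobi_norm io ms dms sym pos iz zt (dJ t tab)).
  case/andP: tab => at_ tb; near=> s; apply/esym; apply: polar_metricE.
    by apply: le_trans a0 _; apply: ltW; near: s; exact: lt_nbhsr.
  apply: dom; apply/andP; split; near: s; [exact: lt_nbhsr | exact: lt_nbhsl].
exists (bil (g c (z c t).1) (W c t) (W c t) - bil (g c (z c t).1)
    (curvature (g c) (z c t).1 (J c t).1 (z c t).2 (z c t).2) (J c t).1).
  exact: (is_derive_jacobi_norm2 io ms dms sym pos iz zt (dJ t tab)).
rewrite lerDl oppr_ge0; apply: (curvature_nonpos sym pos iz).
exact: curv.
Unshelve. all: by end_near. Qed.

Lemma bil_metric_ge0 c x u : (chart_map c @` chart_dom c) x -> 0 <= bil (g c x) u u.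
Proof.
move=> cx; have [->|u0] := eqVneq u 0; first by rewrite bil0l.
exact: ltW (metric_mx_pos g cx u0).
Qed.

Lemma polar_metric_convex t : 0 < t -> derivable phi t 1 /\
  exists2 D, is_derive t 1 (derive1 phi) D & 0 <= D.
Proof.
move=> t0; have [e e0 [dom H]] := local_variation gamv_geodesic t.
set c := chart_at (gamv 0 t) in dom H.
(* A start in the left half of the window, nonnegative so that the variation exists there, and
   before [t] so that [t] is interior. *)
pose a := Num.max 0 (t - e).
have a0 : 0 <= a by rewrite le_max lexx.
have at_ : a < t by rewrite gt_max t0 ltrBlDr ltrDl.
have ta : t - e <= a by rewrite le_max lexx orbT.
have te : t < t + e by rewrite ltrDl.
have dom' s : a < s < t + e -> chart_dom c (gamv 0 s).
  by move=> /andP[s1 s2]; apply: dom; rewrite (le_trans ta (ltW s1)) ltW.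
have ca : chart_dom c (gamv 0 a) by apply: dom; rewrite ta ltW// (lt_trans at_).
have [|_ dJ _] := H a _ (varies_pos a0 ca); first by rewrite ta ltW.
have der := polar_metric_is_derive a0 dom' dJ.
have tab : a < t < t + e by rewrite at_.
have [[dphi _] [D psiD WD]] := der t tab; split; first exact: dphi.
exists (2 * D); last first.
  rewrite mulr_ge0//; apply: le_trans WD; apply: bil_metric_ge0.
  by exists (gamv 0 t) => //; exact: dom'.
apply: (@near_eq_is_derive _ _ _ (fun s => 2 * psi c s)).
  near=> s; have sab : a < s < t + e.
    by apply/andP; split; near: s; [exact: lt_nbhsr | exact: lt_nbhsl].
  by have [[_ <-] _] := der s sab; rewrite derive1E.
Unshelve. all: by end_near. Qed.

(** As [t] decreases to 0, [J] tends to 0 and [W] to [X]. Hence [psi] tends to 0 while its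
    derivative, at least the square norm of [W], is positive. Limits are taken from the right, the
    derivative formulas being available on [(0, e)] only. *)
Lemma polar_metric_initial : \forall t \near (0 : R)^'+, 0 < derive1 phi t.
Proof.
have [e e0 [dom H]] := local_variation gamv_geodesic 0.
have cE : chart_at (gamv 0 0) = chart_at p by rewrite gamv0.
rewrite cE in dom H; set c := chart_at p in dom H.
have e_itv t : 0 < t < e -> 0 - e <= t <= 0 + e.
  by move=> /andP[t0 te]; rewrite sub0r add0r (le_trans _ (ltW t0)) ?oppr_le0 ?ltW.
have c0 : chart_dom c (gamv 0 0) by rewrite gamv0; exact: chart_at_dom.
have [|_ dJ [K K0 JK]] := H 0 _ (varies_pos (lexx 0) c0).
  by rewrite lexx sub0r oppr_le0 ltW.
rewrite add0r in dJ JK.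
have dom' t : 0 < t < e -> chart_dom c (gamv 0 t) by move=> /e_itv; exact: dom.
have der := polar_metric_is_derive (lexx 0) dom' dJ.
have J0 : J c 0 = (0, X) by exact: variation_initial.
(* The Lipschitz bound reaches the endpoint 0 and provides the continuity there. *)
have cvgJ : J c t @[t --> (0 : R)^'+] --> J c 0.
  apply/cvgrPdist_le => r r0; near=> t.
  have t0 : 0 < t by near: t; exact: nbhs_right_gt.
  have te : t < e by near: t; exact: nbhs_right_lt.
  have tr : t <= r / (K + 1).
    by near: t; apply: nbhs_right_le; rewrite divr_gt0// ltr_wpDl.
  apply: le_trans (JK _ _ _ _) _; rewrite ?lexx ?(ltW e0) ?(ltW t0) ?(ltW te)//.
  rewrite sub0r normrN gtr0_norm//.
  have K1 : 0 < K + 1 by rewrite ltr_wpDl.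
  move: tr; rewrite ler_pdivlMr// => /(le_trans _); apply.
  by rewrite mulrC ler_pM2l// lerDl.
have alongJ (f : 'rV[R]_n * 'rV[R]_n -> R) : differentiable f (J c 0) ->
    f (J c t) @[t --> (0 : R)^'+] --> f (J c 0).
  by move=> /differentiable_continuous cf; exact: cvg_comp cvgJ cf.
have Jfst j : (J c t).1 0 j @[t --> (0 : R)^'+] --> (0 : R).
  have := alongJ (fun w => w.1 0 j) (coord_sdiff 0 j (fst_sdiff (J c 0))).1.
  by rewrite J0 mxE.
have Jsnd j : (J c t).2 0 j @[t --> (0 : R)^'+] --> X 0 j.
  have := alongJ (fun w => w.2 0 j) (coord_sdiff 0 j (snd_sdiff (J c 0))).1.
  by rewrite J0.
have zc0 : z c t @[t --> (0 : R)^'+] --> z c 0.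
  apply: cvg_at_right_filter.
  exact: (state_continuous (gamv_geodesic 0) c0).
have along (f : 'rV[R]_n * 'rV[R]_n -> R) : differentiable f (z c 0) ->
    f (z c t) @[t --> (0 : R)^'+] --> f (z c 0).
  by move=> /differentiable_continuous cf; exact: cvg_comp zc0 cf.
have iz : (chart_map c @` chart_dom c) (z c 0).1 by exists (gamv 0 0).
have io := @chart_image_open R n M c.
have ms := @metric_sdiff R n M g c; have dms := @dmetric_sdiff R n M g c.
have sym := @metric_mx_sym R n M g c; have pos := @metric_mx_pos R n M g c.
have Gam k i j : christoffel (g c) k i j (z c t).1 @[t --> (0 : R)^'+] -->
    christoffel (g c) k i j (z c 0).1.
  apply: (along (fun w => christoffel (g c) k i j w.1)).
  have sG := sdiff_comp (fst_sdiff (z c 0)) (christoffel_sdiff io ms dms pos k i j iz).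
  exact: sG.1.
have Gc i j : g c (z c t).1 i j @[t --> (0 : R)^'+] --> g c (z c 0).1 i j.
  apply: (along (fun w => g c w.1 i j)).
  have sG := sdiff_comp (fst_sdiff (z c 0)) (coord_sdiff i j (ms _ iz)).
  exact: sG.1.
have uc i : (z c t).2 0 i @[t --> (0 : R)^'+] --> (z c 0).2 0 i.
  apply: (along (fun w => w.2 0 i)).
  have sG := coord_sdiff 0 i (snd_sdiff (z c 0)).
  exact: sG.1.
(* The Christoffel term of [W] is linear in the position part of [J], which tends to 0. *)
have cvgW k : W c t 0 k @[t --> (0 : R)^'+] --> X 0 k.
  rewrite [X in _ --> X](_ : _ = X 0 k + \sum_i \sum_j
      christoffel (g c) k i j (z c 0).1 * (z c 0).2 0 i * 0); last first.
    by rewrite big1 ?addr0// => i _; rewrite big1// => j _; rewrite mulr0.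
  under eq_fun do rewrite /W mxE [christoffel_form _ _ _ _ _ _]mxE.
  apply: cvgD; first exact: Jsnd.
  apply: cvg_sum => i; apply: cvg_sum => j.
  by apply: cvgM; [apply: cvgM|].
have cvgpsi : psi c t @[t --> (0 : R)^'+] --> (0 : R).
  rewrite [X in _ --> X](_ : _ = \sum_i \sum_j g c (z c 0).1 i j * X 0 i * 0); last first.
    by rewrite big1// => i _; rewrite big1// => j _; rewrite mulr0.
  under eq_fun do rewrite /psi bilE.
  apply: cvg_sum => i; apply: cvg_sum => j.
  by apply: cvgM; [apply: cvgM|].
have /rV0Pn[i Xi] := X_neq0.
have [d d0 Hd] : exists2 d, 0 < d & forall t, 0 < t < d -> t < e /\ W c t 0 i != 0.
  have : \forall t \near (0 : R)^'+, t < e /\ W c t 0 i != 0.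
    near=> t; split; near: t; first exact: nbhs_right_lt.
    exact: cvgr_neq0 (cvgW i) Xi.
  move=> /nbhs_ballP[d d0 Hd]; exists d => // t /andP[t0 td].
  by apply: Hd => //; rewrite -ball_normE /= sub0r normrN gtr0_norm.
have psiD t : 0 < t < d -> is_derive t 1 (psi c) ('D_1 (psi c) t) /\
    0 < 'D_1 (psi c) t.
  move=> td; have [te Wi] := Hd t td; have t0e : 0 < t < e by case/andP: td => ->.
  have [_ [D [dD ED] WD]] := der t t0e; split; first by split.
  rewrite ED; apply: lt_le_trans WD; apply: (metric_mx_pos g).
    by exists (gamv 0 t) => //; exact: dom'.
  by apply/rV0Pn; exists i.
have psi_incr s t : 0 < s -> s < t -> t < d -> psi c s < psi c t.
  move=> s0 st td; have std u : s <= u <= t -> 0 < u < d.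
    by move=> /andP[su ut]; rewrite (lt_le_trans s0 su) (le_lt_trans ut).
  have [||w] := @MVT R (psi c) ('D_1 (psi c)) s t st.
  - by move=> u /itvP us; apply: (psiD u _).1; apply: std; rewrite !us.
  - apply: derivable_within_continuous => u /itvP us.
    have ust : s <= u <= t by rewrite !us.
    by have [[]] := psiD u (std u ust).
  move=> /itvP ws E; rewrite -subr_gt0 E mulr_gt0 ?subr_gt0//.
  by apply: (psiD w _).2; apply: std; rewrite !ws.
(* A negative [psi c t] would lie below [psi c s] for [s] close to 0, against the growth of
   [psi]. *)
have psi_ge0 t : 0 < t < d -> 0 <= psi c t.
  move=> /andP[t0 td]; rewrite leNgt; apply/negP => psit.
  have : \forall s \near (0 : R)^'+, [/\ 0 < s, s < t & psi c t < psi c s].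
    near=> s; split; near: s; [exact: nbhs_right_gt | exact: nbhs_right_lt |
      exact: cvgr_gt cvgpsi _ psit].
  move=> /filter_ex[s [s0 st]]; apply/negP; rewrite -leNgt ltW//.
  exact: psi_incr.
near=> t; have t0 : 0 < t by near: t; exact: nbhs_right_gt.
have td : t < d by near: t; exact: nbhs_right_lt.
have [te _] : t < e /\ W c t 0 i != 0 by apply: Hd; rewrite t0.
have [[_ Ephi] _] : is_derive t 1 phi (2 * psi c t) /\
  exists2 D, is_derive t 1 (psi c) D & bil (g c (z c t).1) (W c t) (W c t) <= D.
  by apply: der; rewrite t0.
rewrite derive1E Ephi mulr_gt0//.
(* An intermediate time turns nonnegativity of [psi] into positivity by strict growth. *)
have t2 : 0 < t / 2 by rewrite divr_gt0.
have t2t : t / 2 < t by rewrite ltr_pdivrMr// ltr_pMr// ltr1n.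
apply: le_lt_trans (psi_incr _ _ t2 t2t td); apply: psi_ge0.
by rewrite t2 (lt_trans t2t).
Unshelve. all: by end_near. Qed.

(** [phi] is convex on positive times, so its derivative at [t] is at least its positive value at
    some earlier time near 0. *)
Lemma polar_metric_derive_gt0 t : 0 < t -> derivable phi t 1 /\ 0 < derive1 phi t.
Proof.
move=> t0; split; first by have [] := polar_metric_convex t0.
have : \forall s \near (0 : R)^'+, [/\ 0 < s, s < t & 0 < derive1 phi s].
  near=> s; split; near: s; [exact: nbhs_right_gt | exact: nbhs_right_lt |
    exact: polar_metric_initial].
move=> /filter_ex[s [s0 st phis]]; apply: lt_le_trans phis _.
have der u : s <= u <= t -> is_derive u 1 (derive1 phi) ('D_1 (derive1 phi) u) /\
    0 <= 'D_1 (derive1 phi) u.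
  move=> /andP[su _]; have [_ [D dD D0]] := polar_metric_convex (lt_le_trans s0 su).
  by case: dD => dD ED; rewrite ED; split.
have [||w] := @MVT R (derive1 phi) ('D_1 (derive1 phi)) s t st.
- by move=> u /itvP us; apply: (der u _).1; rewrite !us.
- apply: derivable_within_continuous => u /itvP us.
  have ust : s <= u <= t by rewrite !us.
  by have [[]] := der u ust.
move=> /itvP ws E; rewrite -subr_ge0 E mulr_ge0//.
  by apply: (der w _).2; rewrite !ws.
by rewrite subr_ge0 ltW.
Unshelve. all: by end_near. Qed.

End radial_expansion.

Theorem theorem34 (R : realType) (n : nat) (hn : (2 <= n)%N)
    (M : smooth_manifold R n) (g : riemannian_metric M)
    (hsc : simply_connected R M)
    (hcomplete : geodesically_complete g)
    (hcurv : nonpositive_sectional_curvature g)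
    (p : M) :
  expanding_radially g p.
Proof.
move=> t v; rewrite /= in_itv/= andbT => t0 _; split.
- exact: derivable_cst.
- by rewrite derive1_cst.
(* Choice assembles the geodesics given by completeness into a family, whose regularity in [h] is a
   conclusion of the lemmas above. *)
move=> X _ X0; have [gamv gamvP] := choice (fun h : R => hcomplete p (v + h *: X)).
exact: (polar_metric_derive_gt0 hcurv gamvP X0 t0).
Qed.
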